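(* Let $\mathcal{A}\subset\mathbb{N}$ be a finite set with $|\mathcal{A}|\ge2$ such that $\mathrm{HD}(F_{\mathcal{A}})>1/2+\delta$, where $\delta>0$. Then there are an integer constant $C_{\mathcal{A}}(\delta)$ and a constant $K_{\mathcal{A}}$ (depending on $\mathcal{A}$ and $\delta$) such that for every prime $p$ there exist positive integers $q$ and $a$ with $0<a<q$, $\gcd(a,q)=1$, $q\le K_{\mathcal{A}}\,p^{C_{\mathcal{A}}(\delta)}$ and $q\equiv0\pmod p$, such that all partial quotients of $a/q$ belong to $\mathcal{A}$.
   Context: For coprime positive integers $0<a<q$, the regular continued fraction expansion is the unique representation $a/q=[0;b_1,\dots,b_s]=\cfrac{1}{b_1+\cfrac{1}{\cdots+\cfrac{1}{b_s}}}$ with positive integers $b_j$ and $b_s\ge2$; the $b_j$ are the partial quotients. $F_{\mathcal{A}}$ denotes the set of irrational numbers in $[0,1]$ all of whose continued fraction partial quotients belong to $\mathcal{A}$, and $\mathrm{HD}$ denotes Hausdorff dimension. *)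

(* Defs.v *)
From Stdlib Require Import Reals Lra Lia ZArith Znumtheory List Arith.
From Coquelicot Require Import Coquelicot.
Open Scope R_scope.

(* diameter of a set U of reals: sup of |x - y| (m_infty for the empty set) *)
Definition diam (U : R -> Prop) : Rbar :=
  Lub_Rbar (fun d => exists x y, U x /\ U y /\ d = Rabs (x - y)).

(* diam(U)^s with the usual conventions: empty set contributes 0,
   0^0 = 1, 0^s = 0 for s > 0; only used when diam U is finite. *)
Definition diam_pow (s : R) (U : R -> Prop) : R :=
  match diam U with
  | Finite d => if Rle_dec d 0 then (if Req_EM_T s 0 then 1 else 0) else Rpower d s
  | _ => 0
  end.

(* sum of a series of nonnegative terms in [0, +oo] *)
Definition sum_Rbar (f : nat -> R) : Rbar :=
  Rbar_lub (fun v => exists n, v = Finite (sum_n f n)).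

Definition hausdorff_delta (s delta : R) (E : R -> Prop) : Rbar :=
  Rbar_glb (fun v => exists U : nat -> R -> Prop,
     (forall x, E x -> exists i, U i x) /\
     (forall i, Rbar_le (diam (U i)) (Finite delta)) /\
     v = sum_Rbar (fun i => diam_pow s (U i))).

Definition hausdorff_measure (s : R) (E : R -> Prop) : Rbar :=
  Rbar_lub (fun v => exists delta, 0 < delta /\ v = hausdorff_delta s delta E).

Definition hausdorff_dim (E : R -> Prop) : Rbar :=
  Rbar_glb (fun t => exists s, t = Finite s /\ 0 <= s /\
                              hausdorff_measure s E = Finite 0).

Definition irrational (x : R) : Prop :=
  ~ exists (m : Z) (n : Z), n <> 0%Z /\ x = IZR m / IZR n.

Definition gauss_map (x : R) : R := / x - IZR (Int_part (/ x)).

(* cf_digit n x = b_{n+1}, the (n+1)-th partial quotient of x in (0,1) irrational *)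
Definition cf_digit (n : nat) (x : R) : Z := Int_part (/ (Nat.iter n gauss_map x)).

Definition F_set (A : list nat) : R -> Prop :=
  fun x => 0 <= x <= 1 /\ irrational x /\
           forall n, exists k, In k A /\ cf_digit n x = Z.of_nat k.

(* partial quotients [b_1; ...; b_s] of a/q (0 < a < q) via the Euclidean
   algorithm: a/q = 1/(q/a + (q mod a)/a) *)
Fixpoint cf_aux (fuel a q : nat) : list nat :=
  match fuel with
  | O => nil
  | S f => if Nat.eqb a 0 then nil else (q / a)%nat :: cf_aux f (q mod a) a
  end.

Definition partial_quotients (a q : nat) : list nat := cf_aux q a q.

(* Main.v *)
(** Let [q(w)] be the continuant of a word [w].  The column [(a, q(w))] of a word
    is the second column of the product of the matrices [[0, 1], [1, b]], so
    [p | q(c w c)] says that this product, reduced modulo [p], satisfies one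
    bilinear equation.

    Covering [F_A] by cylinders, of diameter at most [1 / q(w)^2], shows that a
    dimension above [1/2 + delta] forces at least [const * p^(1 + 2 delta)] words
    with [q(w) < p]; their columns stay distinct modulo [p].  There are only [p]
    possible ratios [a / q], so some ratio is shared by about [p^(2 delta)] words,
    and the quotients of their matrices are lower triangular modulo [p] with that
    many distinct diagonal ratios.  These act by conjugation on the lower
    unipotent subgroup, in which the quotient of the matrices of two letters is a
    nontrivial element, and the pivot argument of sum-product theory then spreads
    this element over almost the whole subgroup in a bounded number of steps.
    Hence bounded products of the matrices and their inverses fill almost all of
    the group.

    Inverses are avoided by tripling: among the sets [D_j], the [3^j]-fold products
    of the matrices, one has [|D_j^3| <= p^(small) |D_j|], so by Ruzsa's inequality
    its products with inverses are hardly larger than [D_j] itself, and [D_j] has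
    more than [const * p^(8/3)] elements.  A second moment count then solves the
    bilinear equation inside [D_j D_j D_j].

    For the finitely many small [p] a word [c ... c] works, because the matrix of
    [c] has finite order modulo [p]. *)

(* Finite continued fractions as integer pairs *)
From Stdlib Require ZArith Znumtheory PeanoNat List.

(** Numerator and denominator of [[0; w]], the empty word giving 0/1. Prepending [b] applies the
    matrix [[0, 1], [1, b]], so the pair is in lowest terms without any division. *)
Fixpoint cf_pair (w : list nat) : nat * nat :=
  match w with
  | nil => (0, 1)
  | cons b w' => (snd (cf_pair w'), b * snd (cf_pair w') + fst (cf_pair w'))
  end.

Notation denom w := (snd (cf_pair w)).

Module ModularHit.

From mathcomp Require Import all_boot all_order all_algebra all_fingroup mxabelem.
From mathcomp Require Import zify ring lra.
Set Implicit Arguments. Unset Strict Implicit. Unset Printing Implicit Defensive.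
Import Order.TTheory GRing.Theory Num.Theory.

(** * Small tripling *)

Section Ruzsa.
Variable gT : finGroupType.
Implicit Types X Y Z D : {set gT}.
Local Open Scope group_scope.

(** Once a factorization [u = x z] is fixed for each [u] in [X * Z], the map
    [(u, y) -> (x y^-1, y z)] is injective: the product of the two coordinates is [u], and then [z]
    gives back [y]. *)
Lemma ruzsa_triangle X Y Z :
  (#|(X * Z)%g| * #|Y| <= #|(X * Y^-1)%g| * #|(Y * Z)%g|)%N.
Proof.
pose d (u : gT) : gT * gT :=
  odflt (1, 1) [pick v : gT * gT | [&& v.1 \in X, v.2 \in Z & v.1 * v.2 == u]].
have dP u : u \in X * Z -> [/\ (d u).1 \in X, (d u).2 \in Z & (d u).1 * (d u).2 = u].
  case/mulsgP=> x z xX zZ ->; rewrite /d; case: pickP => [v /and3P[? ? /eqP]|] //=.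
  by move/(_ (x, z)); rewrite /= xX zZ eqxx.
rewrite -!cardsX.
pose f (w : gT * gT) := ((d w.1).1 * w.2^-1, w.2 * (d w.1).2).
have fI : {in setX (X * Z) Y &, injective f}.
  move=> [u y] [u' y']; rewrite !in_setX /= => /andP[uXZ _] /andP[uXZ' _].
  have [_ _ uE] := dP _ uXZ; have [_ _ uE'] := dP _ uXZ'.
  rewrite /f /=; case => e1 e2.
  have euu : u = u'.
    by rewrite -uE -[(d u).1](mulgKV y) -mulgA e2 e1 mulgA mulgKV uE'.
  by move: e2; rewrite euu => /mulIg ->.
rewrite -(card_in_imset fI) subset_leq_card //; apply/subsetP => _ /imsetP[[u y] + ->].
rewrite in_setX /= => /andP[uXZ yY]; have [dX dZ _] := dP _ uXZ.
by rewrite in_setX /f /= !mem_mulg // mem_invg invgK.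
Qed.

Section Tripling.
Variables (D : {set gT}) (r : rat).
Hypothesis D1 : 1 \in D.
Hypothesis DDD : ((#|(D * D * D)%g|)%:R <= r * (#|D|)%:R :> rat)%R.

Let dgt0 : (0 < #|D|%:R :> rat)%R.
Proof. by rewrite ltr0n card_gt0; apply/set0Pn; exists 1. Qed.

Let DD : ((#|(D * D)%g|)%:R <= r * (#|D|)%:R :> rat)%R.
Proof.
apply: le_trans DDD; rewrite ler_nat subset_leq_card // -{1}[D * D]mulg1.
by rewrite mulgS // sub1set.
Qed.

Lemma tripling_ge1 : (1 <= r)%R.
Proof.
have : ((#|D|)%:R <= r * (#|D|)%:R :> rat)%R.
  apply: le_trans DD; rewrite ler_nat subset_leq_card // -{1}[D]mulg1.
  by rewrite mulgS // sub1set.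
by rewrite -{1}[(#|D|)%:R%R]mul1r ler_pM2r.
Qed.

Let ruzsaR X Y Z c1 c2 : ((#|(X * Y^-1)%g|)%:R <= c1 :> rat)%R ->
  ((#|(Y * Z)%g|)%:R <= c2 * (#|Y|)%:R :> rat)%R -> (0 < #|Y|)%N ->
  ((#|(X * Z)%g|)%:R <= c2 * c1 :> rat)%R.
Proof.
move=> h1 h2 Y0; have := ruzsa_triangle X Y Z; rewrite -(ler_nat rat) !natrM => h.
have Y0' : (0 < #|Y|%:R :> rat)%R by rewrite ltr0n.
rewrite -(ler_pM2r Y0') (le_trans h) // mulrAC mulrC.
by apply: ler_pM.
Qed.

Let dgt0' : (0 < #|D|)%N. Proof. by rewrite -(ltr_nat rat). Qed.
Let DV0 : (0 < #|(D^-1)%g|)%N. Proof. by rewrite card_invg. Qed.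

(* Exchanging a trailing inverse for [D] costs a factor [r], which reduces every
   sign pattern to the positive one. *)
Let swap X : ((#|(X * D^-1)%g|)%:R <= r * (#|(X * D)%g|)%:R :> rat)%R.
Proof. by apply: (ruzsaR (Y := D^-1)); rewrite ?invgK // -invMg !card_invg. Qed.

Let swapV X : ((#|(X * D)%g|)%:R <= r * (#|(X * D^-1)%g|)%:R :> rat)%R.
Proof. exact: (ruzsaR (Y := D)). Qed.

Let double X : ((#|(X * (D * D))%g|)%:R <= r * (#|(X * D^-1)%g|)%:R :> rat)%R.
Proof. by apply: (ruzsaR (Y := D)); rewrite // mulgA. Qed.

Let doubleV X : ((#|(X * (D^-1 * D^-1))%g|)%:R <= r * (#|(X * D)%g|)%:R :> rat)%R.
Proof.
apply: (ruzsaR (Y := D^-1)); rewrite ?invgK //.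
by rewrite -!invMg !card_invg.
Qed.

Definition symset := D :|: D^-1.

(** In [X * symset * symset] the last two factors show four sign patterns. Relative to the size of
    [X * symset], equal signs cost [r] and opposite signs [r ^+ 2], and [2 r + 2 r^2 <= 4 r^3]
    because [1 <= r]. *)
Lemma card_symset_pow n :
  ((#|(symset ^+ n.+1)%g|)%:R <= 2 * (4 * r ^+ 3) ^+ n * (#|D|)%:R :> rat)%R.
Proof.
have r1 := tripling_ge1; have r0 : (0 <= r)%R by apply: le_trans r1.
elim: n => [|n IH].
  rewrite expg1 expr0 mulr1 -natrM ler_nat (leq_trans (leq_card_setU _ _)) //.
  by rewrite card_invg mul2n addnn.
pose X := symset ^+ n; pose m : rat := (#|(X * symset)%g|%:R)%R.
have sD : ((#|(X * D)%g|)%:R <= m)%R by rewrite ler_nat subset_leq_card // mulgS // subsetUl.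
have sV : ((#|(X * D^-1)%g|)%:R <= m)%R by rewrite ler_nat subset_leq_card // mulgS // subsetUr.
have -> : symset ^+ n.+2 = X * symset * symset by rewrite !expgSr.
have m0 : (0 <= m)%R by rewrite ler0n.
have rr : (r <= r ^+ 3)%R by rewrite -{1}[r]expr1 ler_weXn2l.
have rr2 : (r ^+ 2 <= r ^+ 3)%R by rewrite ler_weXn2l.
suff : ((#|(X * symset * symset)%g|)%:R <= (4 * r ^+ 3) * m)%R.
  move/le_trans; apply.
  have -> : (2 * (4 * r ^+ 3) ^+ n.+1 * #|D|%:R)%R
     = ((4 * r ^+ 3) * (2 * (4 * r ^+ 3) ^+ n * #|D|%:R))%R :> rat by rewrite exprS; ring.
  by rewrite ler_wpM2l ?mulr_ge0 ?exprn_ge0 // /m -expgSr.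
have -> : X * symset * symset =
   (X * (D * D) :|: X * D * D^-1) :|: (X * D^-1 * D :|: X * (D^-1 * D^-1)).
  by rewrite /symset mulgU !(mulUg, mulgU) !mulgA setUACA.
have b1 := double X; have b2 := swap (X * D); rewrite -mulgA in b2.
have b3 := swapV (X * D^-1); rewrite -[X * _ * _ ^-1]mulgA in b3; have b4 := doubleV X.
have e1 : ((#|(X * (D * D))%g|)%:R <= r * m)%R by apply: le_trans b1 _; rewrite ler_wpM2l.
have e1' := swap X; have e4 : ((#|(X * (D^-1 * D^-1))%g|)%:R <= r * m)%R.
  by apply: le_trans b4 _; rewrite ler_wpM2l.
have e2 : ((#|(X * (D * D^-1))%g|)%:R <= r * (r * m))%R.
  by apply: le_trans b2 _; rewrite -mulgA ler_wpM2l.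
have e3 : ((#|(X * D^-1 * D)%g|)%:R <= r * (r * m))%R.
  by apply: le_trans b3 _; rewrite ler_wpM2l.
rewrite -[X * D * D^-1]mulgA.
apply: (@le_trans _ _ (r * m + r * (r * m) + (r * (r * m) + r * m))%R).
  apply: le_trans (_ : ((#|(X * (D * D))%g| + #|(X * (D * D^-1))%g| +
    (#|(X * D^-1 * D)%g| + #|(X * (D^-1 * D^-1))%g|))%:R <= _)%R).
    rewrite ler_nat; apply: leq_trans (leq_card_setU _ _) _.
    by rewrite leq_add // leq_card_setU.
  by rewrite !natrD !lerD.
have -> : (r * m + r * (r * m) + (r * (r * m) + r * m) = (r + r^+2 + r^+2 + r) * m)%R by ring.
by rewrite ler_wpM2r //; lra.
Qed.

End Tripling.
End Ruzsa.

(** Otherwise the [L]-th power of the size would gain more than a factor [p] at each of [4 * L]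
    successive triplings and outgrow the [L]-th power of the group order. *)
Lemma tripling_scale (gT : finGroupType) (D : {set gT}) (p L : nat) :
  (1%g \in D) -> (#|gT| <= p ^ 4)%N -> (1 < p)%N -> (0 < L)%N ->
  exists2 j, (j < 4 * L)%N &
    (#|(D ^+ (3 ^ j.+1))%g| ^ L <= p * #|(D ^+ (3 ^ j))%g| ^ L)%N.
Proof.
move=> D1 gp p1 L0; pose d j := #|(D ^+ (3 ^ j))%g|.
suff /existsP[j jP] : [exists j : 'I_(4 * L), d j.+1 ^ L <= p * d j ^ L].
  by exists j.
apply: contraT; rewrite negb_exists => /forallP h.
have d0 j : 0 < d j.
  rewrite card_gt0; apply/set0Pn; exists 1%g; elim: (3 ^ j) => [|k IH]; first by rewrite expg0 inE.
  by rewrite expgS -[1%g](mulg1 1%g) mem_mulg.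
have lt j : j < 4 * L -> p ^ j <= d j ^ L -> p ^ j.+1 < d j.+1 ^ L.
  move=> jL le; have := h (Ordinal jL); rewrite -ltnNge /=; apply: leq_ltn_trans.
  by rewrite expnS leq_mul2l le orbT.
have le j : j <= 4 * L -> p ^ j <= d j ^ L.
  elim: j => [|j IH] jL; first by rewrite expn0 expn_gt0 d0.
  by apply/ltnW/lt => //; apply/IH/ltnW.
have L4 : 4 * L = (4 * L).-1.+1 by rewrite prednK // muln_gt0.
have := lt (4 * L).-1; rewrite -L4 leqnn => /(_ isT); rewrite le ?leq_pred // => /(_ isT).
by rewrite ltnNge expnM leq_exp2r // (leq_trans (max_card _)).
Qed.

(** * Sum-product growth by pivoting *)

(** A pivoting step forms [h1 x - h2 x - g ((x2 - x1) - (h1 x0 - h2 x0))] from elements of level [k]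
    and [x0] of level 1. Subtraction adds levels and multiplication by [G] costs two, which makes
    [4 k + 12]. *)
Fixpoint pivot_level i := if i is i'.+1 then (4 * pivot_level i' + 12)%N else 1%N.

Section Pivot.
Local Open Scope ring_scope.
Variables (F : finFieldType) (G : {set F}) (x0 : F) (lev : nat -> {set F}).
Hypothesis F_prime : forall y : F, exists n, y = n%:R.
Hypothesis x0N0 : x0 != 0.
Hypothesis lev1 : x0 \in lev 1.
Hypothesis levB : forall n m x y, x \in lev n -> y \in lev m -> x - y \in lev (n + m)%N.
Hypothesis levM : forall n g x, g \in G -> x \in lev n -> g * x \in lev n.+2.
Hypothesis lev_mono : forall n m, (n <= m)%N -> lev n \subset lev m.

(** The multiples of a nonzero [x0] exhaust a prime field; hence adding [x0] must lead out of a
    proper ratio set somewhere. *)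
Lemma additively_closed_full (Q : {set F}) :
  0 \in Q -> (forall q, q \in Q -> q + x0 \in Q) -> Q = setT.
Proof.
move=> Q0 QS; apply/setP => y; rewrite inE.
have [n yE] := F_prime (y / x0); have -> : y = n%:R * x0 by rewrite -yE mulfVK.
elim: n {yE} => [|n IH]; first by rewrite mul0r.
by rewrite mulrSr mulrDl mul1r QS.
Qed.

(* If the ratio set [Q = (X - X) / (G' - G')] is the whole field, then [X - X] is
   large.  Otherwise some [q] in [Q] has [q + x0] outside [Q], so the map
   [(x, g) |-> x + g (q + x0)] is injective, and clearing the denominator of [q]
   keeps its image at a bounded level. *)
Lemma pivot_growth (t m : nat) : (t <= #|G|)%N -> (#|F| < t ^ m.+1)%N ->
  exists2 X : {set F}, X \subset lev (pivot_level m.+1) & (#|F| <= #|X| * t ^ 2)%N.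
Proof.
move=> tG pt.
have t1 : (1 < t)%N.
  rewrite ltnNge; apply: contraTN pt => t1; rewrite -leqNgt.
  by apply: leq_trans (ltnW (card_finNzRing_gt1 F)); case: (t) t1 => [|[]] //;
    rewrite ?exp0n ?exp1n.
have [G' G'G cG'] : exists2 G' : {set F}, G' \subset G & #|G'| = t.
  exists [set x in take t (enum G)].
    by apply/subsetP => x; rewrite inE => /mem_take; rewrite mem_enum.
  rewrite cardsE (card_uniqP _) ?take_uniq ?enum_uniq // size_takel //.
  by rewrite -cardE.
have [g1 [g2 [g1G g2G g12]]] : exists g1 g2, [/\ g1 \in G', g2 \in G' & g1 != g2].
  by move: t1; rewrite -cG' => /card_gt1P[x [y [*]]]; exists x, y.
(* Each stage either has reached the target or multiplies the size by [t]; the second cannot persist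
   to stage [m.+1], as [t ^ m.+1] exceeds the size of the field. *)
suff claim i : (exists2 X : {set F}, X \subset lev (pivot_level i) & (#|F| <= #|X| * t ^ 2)%N)
   \/ (exists2 X : {set F}, X \subset lev (pivot_level i) & (t ^ i <= #|X|)%N).
  case: (claim m.+1) => // -[X _ tX]; have := leq_trans pt (leq_trans tX (max_card _)).
  by rewrite ltnn.
elim: i => [|i [[X Xl Xp]|[X Xl tX]]].
- by right; exists [set x0]; rewrite ?sub1set ?cards1.
- left; exists X => //; apply: subset_trans Xl (lev_mono _) => /=; lia.
have [x3 x3X] : exists x, x \in X.
  by apply/set0Pn; rewrite -card_gt0 (leq_trans _ tX) // expn_gt0 ltnW.
pose f (w : (F * F) * (F * F)) := (w.1.1 - w.1.2) / (w.2.1 - w.2.2).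
pose Q := [set f w | w in [set w | [&& w.1.1 \in X, w.1.2 \in X, w.2.1 \in G', w.2.2 \in G'
   & w.2.1 != w.2.2]]].
have inQ x y g h : x \in X -> y \in X -> g \in G' -> h \in G' -> g != h ->
    (x - y) / (g - h) \in Q.
  by move=> *; apply/imsetP; exists ((x, y), (g, h)); rewrite // inE; apply/and5P.
have [QT|QT] := eqVneq Q setT.
  left; exists [set w.1 - w.2 | w in setX X X].
    apply/subsetP => _ /imsetP[[x y] /setXP[/= xX yX] ->].
    have := levB (subsetP Xl _ xX) (subsetP Xl _ yX).
    apply: (subsetP (lev_mono _)) => /=; lia.
  pose XX := [set w.1 - w.2 | w in setX X X]; rewrite -/XX.
  pose h (w : F * (F * F)) := w.1 / (w.2.1 - w.2.2).
  have sQ : Q \subset h @: setX XX (setX G' G').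
    apply/subsetP => _ /imsetP[[[x y] [g k]] + ->].
    rewrite inE /= => /and5P[xX yX gG kG _]; apply/imsetP; exists (x - y, (g, k)) => //.
    by rewrite !in_setX /= gG kG !andbT; apply/imsetP; exists (x, y); rewrite // in_setX xX.
  move: (subset_leq_card sQ); rewrite QT cardsT => /leq_trans; apply.
  by apply: leq_trans (leq_imset_card _ _) _; rewrite !cardsX cG' mulnn.
have [q qQ qx0] : exists2 q, q \in Q & q + x0 \notin Q.
  apply/exists_inP; apply: contraNT QT; rewrite negb_exists_in => /forall_inP h.
  apply/eqP/additively_closed_full => [|q qQ]; last by have := h q qQ; rewrite negbK.
  by rewrite -(mul0r (g1 - g2)^-1) -(subrr x3) inQ.
case/imsetP: qQ => -[[x1 x2] [h1 h2]] + qE; rewrite inE /= => /and5P[x1X x2X h1G h2G h12].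
have h12' : h1 - h2 != 0 by rewrite subr_eq0.
(* Levels are controlled for differences only, so the sum is written as a difference, with [x1] and
   [x2] exchanged. *)
pose psi (w : F * F) := (h1 * w.1 - h2 * w.1) - w.2 * ((x2 - x1) - (h1 * x0 - h2 * x0)).
have psiE w : psi w = (h1 - h2) * (w.1 + w.2 * (q + x0)).
  rewrite qE /f /psi /=; field; exact: h12'.
right; exists [set psi w | w in setX X G'].
  apply/subsetP => _ /imsetP[[x g] /setXP[/= xX gG] ->]; rewrite /psi /=.
  have inl := subsetP Xl; have inG := subsetP G'G.
  have a1 := levM (inG _ h1G) (inl _ xX); have a2 := levM (inG _ h2G) (inl _ xX).
  have a3 := levB (inl _ x2X) (inl _ x1X).
  have a4 := levB (levM (inG _ h1G) lev1) (levM (inG _ h2G) lev1).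
  apply: (subsetP (lev_mono _)) (levB (levB a1 a2) (levM (inG _ gG) (levB a3 a4))).
  by move: (pivot_level i) => k; clear; rewrite /=; lia.
rewrite card_in_imset ?cardsX ?cG' ?expnSr ?leq_mul2r ?tX ?orbT //.
move=> [x g] [y h] /setXP[/= xX gG] /setXP[/= yX hG]; rewrite !psiE /= => /(mulfI h12') e.
have [gh|gh] := eqVneq g h; first by move: e; rewrite gh => /addIr ->.
case/negP: qx0; have gh' : h - g != 0 by rewrite subr_eq0 eq_sym.
suff -> : q + x0 = (x - y) / (h - g) by apply: inQ; rewrite // eq_sym.
apply: (mulIf gh'); rewrite mulfVK //; apply/eqP; move: e.
move: (q + x0) => z e; rewrite mulrBr -subr_eq0 opprB.
have -> : z * h - z * g + (y - x) = (y + h * z) - (x + g * z) by ring.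
by rewrite e subrr.
Qed.
End Pivot.

(** * Counting orthogonal vectors *)

Lemma leq_card_fiber (aT rT : finType) (f : aT -> rT) (A : {set aT}) k :
  (forall y, #|[set x in A | f x == y]| <= k) -> #|A| <= k * #|f @: A|.
Proof.
move=> fk; rewrite -sum1_card (partition_big_imset f) /= mulnC -sum_nat_const.
apply: leq_sum => y _; rewrite (leq_trans _ (fk y)) // -sum1_card.
by apply: eq_leq; apply: eq_bigl => x; rewrite inE.
Qed.

Lemma pigeonhole (aT rT : finType) (f : aT -> rT) :
  0 < #|aT| -> exists y, #|aT| <= #|rT| * #|[set x | f x == y]|.
Proof.
move=> aT0; case/card_gt0P: (aT0) => x0 _.
pose y0 := [arg max_(y > f x0) #|[set x | f x == y]|]; exists y0.
have ymax y : #|[set x | f x == y]| <= #|[set x | f x == y0]|.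
  by rewrite /y0; case: arg_maxnP => // z _; apply.
rewrite -cardsT; apply: leq_trans (@leq_card_fiber _ _ f setT _ _) _.
  move=> y; apply: leq_trans (ymax y); apply/subset_leq_card/subsetP => x.
  by rewrite !inE.
by rewrite mulnC leq_mul2r max_card orbT.
Qed.

Section Orthogonal.
Local Open Scope ring_scope.
Variables (F : finFieldType) (n : nat).
Implicit Types (e f : 'rV[F]_n.+2) (S E : {set 'rV[F]_n.+2}).
Notation q := #|F|.

Lemma card_left_kernel k (C : 'M[F]_(n.+2, k)) :
  #|[set e : 'rV[F]_n.+2 | e *m C == 0]| = (q ^ (n.+2 - \rank C))%N.
Proof.
rewrite -mxrank_ker -card_rowg; apply: eq_card => e.
by rewrite inE mem_rowg sub_kermx.
Qed.

Lemma card_hyperplane f : f != 0 -> #|[set e : 'rV[F]_n.+2 | e *m f^T == 0]| = (q ^ n.+1)%N.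
Proof. by move=> f0; rewrite card_left_kernel mxrank_tr rank_rV f0 subn1. Qed.

(** The codimension is two unless [g] is a multiple of [f], and then the second condition follows
    from the first. *)
Lemma card_two_hyperplanes (f g : 'rV[F]_n.+2) : f != 0 ->
  (#|[set e : 'rV[F]_n.+2 | (e *m f^T == 0) && (e *m g^T == 0)]%R|
     <= q ^ n + (g <= f)%MS * q ^ n.+1)%N.
Proof.
move=> f0; have [gf|gf] := boolP (g <= f)%MS.
  rewrite mul1n (leq_trans _ (leq_addl _ _)) // -(card_hyperplane f0) subset_leq_card //.
  by apply/subsetP => e; rewrite !inE => /andP[].
rewrite mul0n addn0.
have -> : [set e : 'rV[F]_n.+2 | (e *m f^T == 0) && (e *m g^T == 0)] =
   [set e : 'rV[F]_n.+2 | e *m (row_mx f^T g^T) == 0].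
  apply/setP => e; rewrite !inE mul_mx_row.
  apply/idP/eqP => [/andP[/eqP -> /eqP ->]|]; first exact: row_mx0.
  by rewrite -row_mx0 => /eq_row_mx[-> ->]; rewrite !eqxx.
rewrite card_left_kernel -tr_col_mx mxrank_tr leq_exp2l ?card_finNzRing_gt1 //.
rewrite -addsmxE.
have : (f < f + g)%MS.
  by rewrite ltmxE addsmxSl /=; apply: contra gf => /(submx_trans (addsmxSr _ _)).
by rewrite ltmxErank rank_rV f0 => /andP[_ h]; rewrite leq_subLR -[in leqLHS]addn2 addnC leq_add2r.
Qed.

(* Second moment: under a uniform [e] the forms [e . s], for [s] in [S], vanish
   pairwise independently unless they are proportional. *)
Lemma orthogonality_free S E : 0 \notin S ->
  {in E & S, forall e s, e *m s^T != 0} -> (#|E| * #|S| <= q ^ n.+4)%N.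
Proof.
move=> S0 ES; pose Z e : int := \sum_(s in S) (e *m s^T == 0)%:R.
have [->|SN0] := eqVneq S set0; first by rewrite cards0 muln0.
have S_gt0 : (0 < #|S|)%N by rewrite card_gt0.
pose Q : int := q%:R; pose s : int := #|S|%:R.
have cnt (P : pred 'rV[F]_n.+2) : \sum_e (P e)%:R = #|[set e : 'rV[F]_n.+2 | P e]|%:R :> int.
  by rewrite -natr_sum -sum1_card [in RHS]big_mkcond /=; congr _%:R; apply: eq_bigr => e _;
    rewrite inE; case: (P e).
have sumZ : \sum_e Z e = s * Q ^+ n.+1.
  rewrite exchange_big /= /s -sumr_const mulr_suml; apply: eq_bigr => f fS.
  by rewrite cnt card_hyperplane ?mul1r ?natrX //; apply: contraNneq S0 => <-.
have sumZ2 : \sum_e Z e ^+ 2 <= s ^+ 2 * Q ^+ n + s * Q ^+ n.+2.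
  have -> : \sum_e Z e ^+ 2 = \sum_(f in S) \sum_(g in S)
      #|[set e : 'rV[F]_n.+2 | (e *m f^T == 0) && (e *m g^T == 0)]|%:R.
    transitivity (\sum_(e : 'rV[F]_n.+2) \sum_(f in S) \sum_(g in S) ((e *m f^T == 0) && (e *m g^T == 0))%:R : int).
      apply: eq_bigr => e _; rewrite expr2 mulr_suml; apply: eq_bigr => f _.
      by rewrite mulr_sumr; apply: eq_bigr => g _; rewrite -natrM mulnb.
    rewrite exchange_big; apply: eq_bigr => f _; rewrite exchange_big; apply: eq_bigr => g _.
    exact: cnt.
  have -> : s ^+ 2 * Q ^+ n + s * Q ^+ n.+2 = \sum_(f in S) (s * Q ^+ n + Q ^+ n.+2).
    by rewrite sumr_const -mulr_natl -/s; ring.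
  apply: ler_sum => f fS; have f0 : f != 0 by apply: contraNneq S0 => <-.
  apply: (@le_trans _ _ (\sum_(g in S) (Q ^+ n + (g <= f)%MS%:R * Q ^+ n.+1))).
    apply: ler_sum => g _; have := card_two_hyperplanes g f0.
    by rewrite -(ler_nat int) natrD natrM !natrX.
  rewrite big_split /= sumr_const -mulr_natl -/s lerD2l -mulr_suml [Q ^+ n.+2]exprS.
  rewrite ler_wpM2r ?exprn_ge0 ?ler0n // -natr_sum ler_nat.
  have -> : q = #|rowg f| by rewrite card_rowg rank_rV f0 expn1.
  rewrite -sum1_card big_mkcond [leqRHS]big_mkcond; apply: leq_sum => g _ /=.
  by rewrite mem_rowg; case: (g \in S); case: (g <= f)%MS.
(* [Q * Z e - s] is [Q] times the deviation of [Z e] from its mean [s / Q]. On [E] the count [Z e]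
   vanishes, so each such vector contributes [s ^+ 2]. *)
have low : #|E|%:R * s ^+ 2 <= \sum_e (Q * Z e - s) ^+ 2.
  rewrite [leRHS](bigID (mem E)) /= -[leLHS]addr0 lerD //; last first.
    by apply: sumr_ge0 => e _; rewrite sqr_ge0.
  rewrite mulr_natl -sumr_const ler_sum // => e eE.
  rewrite [Z e]big1 ?mulr0 ?sub0r ?sqrrN // => f fS.
  by rewrite (negbTE (ES _ _ eE fS)).
have up : \sum_e (Q * Z e - s) ^+ 2 <= s * Q ^+ n.+4.
  have -> : \sum_e (Q * Z e - s) ^+ 2 =
     Q ^+ 2 * (\sum_e Z e ^+ 2) - 2 * Q * s * (\sum_e Z e) + s ^+ 2 * Q ^+ n.+2.
    transitivity (\sum_e (Q ^+ 2 * Z e ^+ 2 - 2 * Q * s * Z e + s ^+ 2)).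
      by apply: eq_bigr => e _; ring.
    rewrite big_split /= sumrB sumr_const -[_ *+ #|_|]mulr_natr card_mx mul1n natrX.
    by congr (_ - _ + _); rewrite mulr_sumr.
  rewrite sumZ.
  have -> : s * Q ^+ n.+4 = Q ^+ 2 * (s ^+ 2 * Q ^+ n + s * Q ^+ n.+2)
    - 2 * Q * s * (s * Q ^+ n.+1) + s ^+ 2 * Q ^+ n.+2 by rewrite !exprS; ring.
  by rewrite !lerD2r ler_wpM2l ?exprn_ge0 ?ler0n.
have := le_trans low up;
  rewrite -(ler_nat int) natrM natrX expr2 mulrA mulrC [s * Q ^+ _]mulrC mulrC.
by rewrite ler_pM2r // ltr0n.
Qed.
End Orthogonal.

(** * Two-by-two matrices *)

Lemma ord2_cases (P : 'I_2 -> Prop) : P 0%R -> P 1%R -> forall i, P i.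
Proof.
by move=> P0 P1 [[|[|//]] h]; [have -> : Ordinal h = 0%R | have -> : Ordinal h = 1%R] => //;
  apply: val_inj.
Qed.

Section Matrix2.
Local Open Scope ring_scope.
Variable R : comNzRingType.

Definition mx2 (a b c d : R) : 'M[R]_2 :=
  \matrix_(i, j) if i == 0 then (if j == 0 then a else b) else (if j == 0 then c else d).

Lemma mx2E (N : 'M[R]_2) : N = mx2 (N 0 0) (N 0 1) (N 1 0) (N 1 1).
Proof.
by apply/matrixP; apply: ord2_cases; apply: ord2_cases; rewrite mxE.
Qed.

Lemma mul_mx2 a b c d a' b' c' d' : mx2 a b c d *m mx2 a' b' c' d' =
  mx2 (a * a' + b * c') (a * b' + b * d') (c * a' + d * c') (c * b' + d * d').
Proof.
apply/matrixP => i j; rewrite mxE !big_ord_recl big_ord0 addr0 !mxE /=.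
by elim/ord2_cases: i; elim/ord2_cases: j; rewrite //= mxE.
Qed.

Lemma det_mx2 a b c d : \det (mx2 a b c d) = a * d - b * c.
Proof.
rewrite (expand_det_row _ 0) !big_ord_recl big_ord0 /cofactor !det_mx11 !mxE /=.
by ring.
Qed.

Definition col2 (x y : R) : 'cV[R]_2 := \col_i if i == 0 then x else y.

Lemma mul_mx2_col2 a b c d x y :
  mx2 a b c d *m col2 x y = col2 (a * x + b * y) (c * x + d * y).
Proof.
apply/matrixP => i j; rewrite mxE !big_ord_recl big_ord0 addr0 !mxE /=.
by elim/ord2_cases: i; rewrite //= mxE.
Qed.

Lemma col2E (v : 'cV[R]_2) : v = col2 (v 0 0) (v 1 0).
Proof. by apply/matrixP => i j; rewrite ord1 mxE; elim/ord2_cases: i. Qed.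

Lemma col2_inj x y x' y' : col2 x y = col2 x' y' -> x = x' /\ y = y'.
Proof. by move/matrixP => h; have := h 0 0; have := h 1 0; rewrite !mxE. Qed.

Lemma mx2_inj a b c d a' b' c' d' : mx2 a b c d = mx2 a' b' c' d' ->
  [/\ a = a', b = b', c = c' & d = d'].
Proof.
by move/matrixP => h; have := h 0 0; have := h 0 1; have := h 1 0; have := h 1 1; rewrite !mxE.
Qed.
End Matrix2.

(** * A bilinear equation solved by three factors from a large set *)

Section Dense.
Local Open Scope ring_scope.
Variable F : finFieldType.
Notation q := #|F|.
Implicit Types (D : {set 'M[F]_2}) (N : 'M[F]_2).

(** Given the image vector, a matrix is determined by its determinant, which is 1 or -1, and one
    entry of its second column. *)
Lemma card_orbit_col D (c : F) : {in D, forall N, \det N ^+ 2 = 1} ->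
  (#|D| <= 2 * q * #|[set (N *m col2 1 c)%R | N in D]|)%N.
Proof.
move=> dD; apply: leq_card_fiber => v.
(* For a given image [v] the determinant equals [v0 * N 1 1 - v1 * N 0 1], which yields the entry
   that [h] does not record. *)
pose h N := (\det N == 1, if v 0 0 == 0 then N 1 1 else N 0 1).
have -> : (2 * q)%N = #|{: bool * F}| by rewrite card_prod card_bool.
rewrite -(card_in_imset (f := h)); last first.
  move=> N N'; rewrite !inE => /andP[ND /eqP Nv] /andP[N'D /eqP N'v] [].
  have detE M M' : M \in D -> M' \in D -> (\det M == 1) = (\det M' == 1) -> \det M = \det M'.
    move=> /dD/eqP + /dD/eqP; rewrite !sqrf_eq1 => /orP[/eqP->|/eqP->] /orP[/eqP->|/eqP->] //.
      by rewrite eqxx => /esym/eqP.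
    by rewrite eqxx => /eqP.
  move=> /(detE _ _ ND N'D).
  have : \det N != 0 by apply/eqP => d0; have := dD _ ND; rewrite d0 expr0n => /esym/eqP;
    rewrite oner_eq0.
  move: Nv N'v; rewrite (mx2E N) (mx2E N') (col2E v) !mul_mx2_col2 !det_mx2 !mxE /= !mulr1.
  move: (N 0 0) (N 0 1) (N 1 0) (N 1 1) (N' 0 0) (N' 0 1) (N' 1 0) (N' 1 1) (v 0 0) (v 1 0).
  move=> n00 n01 n10 n11 m00 m01 m10 m11 v0 v1 /col2_inj[e0 e1] /col2_inj[f0 f1] dN0 dE.
  have {}e0 : n00 = v0 - n01 * c by rewrite -e0 addrK.
  have {}f0 : m00 = v0 - m01 * c by rewrite -f0 addrK.
  have {}e1 : n10 = v1 - n11 * c by rewrite -e1 addrK.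
  have {}f1 : m10 = v1 - m11 * c by rewrite -f1 addrK.
  move: dN0 dE; rewrite e0 e1 f0 f1.
  have -> a b : (v0 - a * c) * b - a * (v1 - b * c) = v0 * b - a * v1 by ring.
  rewrite (_ : (v0 - m01 * c) * m11 - m01 * (v1 - m11 * c) = v0 * m11 - m01 * v1); last by ring.
  have [->|z] := eqVneq v0 0; rewrite ?mul0r ?sub0r ?oppr_eq0.
    rewrite mulf_eq0 negb_or => /andP[_ v10] /oppr_inj/(mulIf v10) -> ->; by [].
  by move=> _ + eq; rewrite eq => /addIr/(mulfI z) ->.
exact: max_card.
Qed.

Lemma card_orbit_row D (c : F) : {in D, forall N, \det N ^+ 2 = 1} ->
  (#|D| <= 2 * q * #|[set ((col2 1 c)^T *m N)%R | N in D]|)%N.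
Proof.
move=> dD; have := @card_orbit_col (trmx @: D) c.
rewrite card_imset; last exact: trmx_inj.
move=> h; apply: leq_trans (h _) _; first by move=> _ /imsetP[N ND ->]; rewrite det_tr dD.
rewrite leq_mul2l; apply/orP; right.
rewrite -(card_imset _ (@trmx_inj _ _ _)); apply/subset_leq_card/subsetP => v.
case/imsetP => _ /imsetP[_ /imsetP[N ND ->] ->] ->; apply/imsetP; exists N => //.
by rewrite trmx_mul trmxK.
Qed.

(** A rank-one product of nonzero vectors determines its factors up to [(l x, l^-1 y)], so each
    fiber has at most [q] elements. *)
Lemma card_tensor (X Y : {set 'rV[F]_2}) : 0 \notin X -> 0 \notin Y ->
  (#|X| * #|Y| <= q * #|[set (mxvec (w.1^T *m w.2))%R | w in setX X Y]|)%N.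
Proof.
move=> X0 Y0; rewrite -cardsX; apply: leq_card_fiber => v.
set A := [set _ in _ | _]; have [->|[[x0 y0]]] := set_0Vmem A; first by rewrite cards0.
rewrite inE /= in_setX /= => /andP[/andP[x0X y0Y] /eqP vE].
have x0N : x0 != 0 by apply: contraNneq X0 => <-.
apply: leq_trans (_ : #|[set (l *: x0, l^-1 *: y0) | l in F]| <= _)%N; last exact: leq_imset_card.
apply/subset_leq_card/subsetP => -[x y]; rewrite inE in_setX /= => /andP[/andP[xX yY] /eqP].
rewrite -vE => /(can_inj mxvecK)/matrixP e.
have eij i j : x 0 i * y 0 j = x0 0 i * y0 0 j.
  by have := e i j; rewrite !mxE !big_ord1 !mxE.
have /rV0Pn[j yj] : y != 0 by apply: contraNneq Y0 => <-.
have xN : x != 0 by apply: contraNneq X0 => <-.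
have /rV0Pn[i x0i] := x0N.
pose l := y0 0 j / y 0 j.
have xE : x = l *: x0.
  apply/rowP => k; rewrite !mxE; apply: (mulIf yj); rewrite eij /l.
  by rewrite mulrAC mulfVK // mulrC.
have l0 : l != 0 by apply: contraNneq xN => l0; rewrite xE l0 scale0r.
apply/imsetP; exists l => //; rewrite -xE; congr pair; apply/rowP => k; rewrite !mxE.
apply: (mulfI x0i); apply: (mulfI l0); rewrite [RHS]mulrCA mulVKf // -eij.
by rewrite xE !mxE mulrA.
Qed.

(* Scalars do not affect the bilinear equation, but with them the matrices become
   dense among all of ['M[F]_2]. *)
Lemma card_scaled D : {in D, forall N, \det N ^+ 2 = 1} ->
  (q.-1 * #|D| <= 4 * #|[set w.1 *: w.2 | w in setX [set~ (0 : F)] D]%R|)%N.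
Proof.
move=> dD; rewrite -(cardsC1 (0 : F)) -cardsX; apply: leq_card_fiber => M.
(* From [M = l N] and [det N ^+ 2 = 1] comes [l ^ 4 = det M ^+ 2], which has at most four solutions,
   and [l] determines [N]. *)
pose P : {poly F} := 'X^4 - (\det M ^+ 2)%:P.
pose Z := [set l : F | root P l].
have sP : size P = 5 by rewrite size_XnsubC.
have Z4 : (#|Z| <= 4)%N.
  have := @max_poly_roots _ P (enum Z); rewrite sP ltnS -cardE; apply.
  - by rewrite -size_poly_eq0 sP.
  - by apply/allP => l; rewrite mem_enum inE.
  - exact: enum_uniq.
apply: leq_trans Z4; set A := [set _ in _ | _].
have AP w : w \in A -> [/\ w.1 != 0, w.2 \in D & w.1 *: w.2 = M].
  by case: w => l N; rewrite inE in_setX !inE /= => /andP[/andP[? ?] /eqP].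
rewrite -(card_in_imset (f := fst)) => [|[l N] [l' N'] /AP[/= l0 _ e] /AP[/= _ _ e'] ll].
  apply/subset_leq_card/subsetP => _ /imsetP[w /AP[l0 ND e] ->].
  rewrite inE rootE !hornerE -e detZ exprMn dD // mulr1 -exprM subrr //.
by rewrite -ll in e' *; move: e; rewrite -e' => /(scalerI l0) ->.
Qed.

(** The form [x N y^T] is the scalar product of [N] with the tensor of [x] and [y]. Without a
    solution, [orthogonality_free] in dimension 4 bounds the number of tensors times that of scaled
    matrices by [q ^ 6]. With [d = #|D|] these are at least [d^2 / (4 q^3)] and [q d / 8], whence
    [d^3 <= 32 q^8]. *)
Lemma three_fold_hit D (c : F) : {in D, forall N, \det N ^+ 2 = 1} ->
  (32 * q ^ 8 < #|D| ^ 3)%N ->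
  exists N1 N2 N3, [/\ N1 \in D, N2 \in D, N3 \in D &
    (col2 1 c)^T *m N1 *m N2 *m (N3 *m col2 1 c) = 0].
Proof.
move=> dD big; pose f := col2 1 c.
have [/existsP[N1 /existsP[N2 /existsP[N3 /and4P[D1 D2 D3 /eqP e]]]]|] := boolP
  [exists N1, exists N2, exists N3, [&& N1 \in D, N2 \in D, N3 \in D
   & f^T *m N1 *m N2 *m (N3 *m f) == 0]]; first by exists N1, N2, N3.
move/existsPn => no; exfalso; move: big; apply/negP; rewrite -leqNgt.
have detN N : N \in D -> N \in unitmx.
  move=> /dD d; rewrite unitmxE unitfE; apply/eqP => d0; move: d; rewrite d0 expr0n.
  by move/esym/eqP; rewrite oner_eq0.
have f0 : f != 0 by apply/eqP => /matrixP/(_ 0 0); rewrite !mxE /= => /eqP; rewrite oner_eq0.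
pose X := [set f^T *m N | N in D]; pose Y := [set (N *m f)^T | N in D].
have X0 : 0 \notin X.
  apply/imsetP => -[N /detN uN] /(congr1 (mulmx^~ (invmx N))).
  by rewrite mulmxK // mul0mx => /esym/eqP; rewrite trmx_eq0 (negbTE f0).
have Y0 : 0 \notin Y.
  apply/imsetP => -[N /detN uN] /esym/eqP; rewrite trmx_eq0 => /eqP/(congr1 (mulmx (invmx N))).
  by rewrite mulKmx // mulmx0 => /eqP; rewrite (negbTE f0).
have cX := card_orbit_row c dD; have cY := card_orbit_col c dD.
rewrite -/f -/X in cX; rewrite -/f in cY.
have YE : #|Y| = #|[set (N *m f)%R | N in D]|.
  rewrite -(card_imset _ (@trmx_inj F 2 1)); apply: eq_card => v.
  apply/imsetP/imsetP => [[N ND ->]|[_ /imsetP[N ND ->] ->]]; last by exists N.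
  by exists (N *m f) => //; apply: imset_f.
rewrite -YE in cY.
have cT := card_tensor X0 Y0; have cS := card_scaled dD.
set E := [set _ | w in _] in cT; set S' := [set _ | w in _] in cS.
pose S := mxvec @: S'.
have SE : #|S| = #|S'| by rewrite card_imset //; exact: can_inj mxvecK.
have S0 : 0 \notin S.
  apply/imsetP => -[_ /imsetP[[l N] + ->]]; rewrite in_setX !inE /= => /andP[l0 ND].
  rewrite -[0](linear0 mxvec) => /(can_inj mxvecK)/esym/eqP; rewrite scaler_eq0 (negbTE l0) /=.
  by move=> /eqP N0; have := detN _ ND; rewrite N0 unitmxE det0 unitr0.
have ES : {in E & S, forall e s, e *m s^T != 0}.
  move=> e s /imsetP[[x y] + ->] /imsetP[M + ->]; rewrite in_setX /=.
  case/andP=> /imsetP[N1 D1 ->] /imsetP[N3 D3 ->] /imsetP[[l N] + ->].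
  rewrite in_setX !inE /= => /andP[l0 ND].
  rewrite mxvec_dotmul -scalemxAr -scalemxAl scaler_eq0 (negbTE l0) /=.
  have /existsPn/(_ N)/existsPn/(_ N3) := no N1.
  by rewrite D1 ND D3 /= trmxK.
have := @orthogonality_free F 2 S E S0 ES; rewrite SE => cES.
have q1 : (1 < q)%N := card_finNzRing_gt1 F.
move: cX cY cT cS cES q1; move: #|X| #|Y| #|E| #|S'| #|D| (#|F|) => a b e s d k.
move=> cX cY cT cS cES q1.
have h1 : (k * d <= 8 * s)%N.
  apply: leq_trans (_ : 2 * (k.-1 * d) <= _)%N; last lia.
  by rewrite mulnA leq_mul2r; apply/orP; right; lia.
have h2 : (k * (d * (d * d)) <= 8 * s * ((2 * k * a) * (2 * k * b)))%N.
  by rewrite mulnA leq_mul // leq_mul.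
have h3 : (8 * s * ((2 * k * a) * (2 * k * b)) <= 32 * k ^ 3 * (s * e))%N.
  have -> : (8 * s * ((2 * k * a) * (2 * k * b)) =
    32 * k ^ 2 * s * (a * b))%N by rewrite !expnS expn0; ring.
  have -> : (32 * k ^ 3 * (s * e) = 32 * k ^ 2 * s * (k * e))%N by rewrite !expnS expn0; ring.
  by rewrite leq_mul2l cT orbT.
have h4 : (32 * k ^ 3 * (s * e) <= 32 * k ^ 3 * k ^ 6)%N by rewrite leq_mul2l [(s * e)%N]mulnC cES orbT.
have := leq_trans (leq_trans h2 h3) h4.
have -> : (k * (d * (d * d)) = k * d ^ 3)%N by rewrite !expnS expn0 muln1.
have -> : (32 * k ^ 3 * k ^ 6 = k * (32 * k ^ 8))%N by rewrite !expnS expn0; ring.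
by rewrite leq_pmul2l //; lia.
Qed.
End Dense.

(** * Continuants modulo p *)

Definition positive (w : seq nat) := all (leq 1) w.

Lemma denom_gt0 w : positive w -> 0 < denom w.
Proof.
elim: w => //= b w IH /andP[b0 /IH]; rewrite !(multE, plusE) => w0.
by rewrite addn_gt0 muln_gt0 b0 w0.
Qed.

Lemma numer_le_denom w : positive w -> (cf_pair w).1 <= denom w.
Proof.
case: w => //= b w /andP[b0 w0]; rewrite !(multE, plusE).
by apply: leq_trans (leq_addr _ _); rewrite leq_pmull.
Qed.

(** The matrix product of [u] acting on an arbitrary column; [cf_pair u] is its value at
    [(0, 1)]. *)
Definition cf_act (u : seq nat) (v : nat * nat) : nat * nat :=
  foldr (fun b v => (v.2, b * v.2 + v.1)) v u.

Lemma cf_act_cat u w : cf_pair (u ++ w) = cf_act u (cf_pair w).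
Proof. by elim: u => //= b u ->. Qed.

Lemma cf_act_lin u k l v w :
  cf_act u (k * v.1 + l * w.1, k * v.2 + l * w.2) =
  (k * (cf_act u v).1 + l * (cf_act u w).1, k * (cf_act u v).2 + l * (cf_act u w).2).
Proof. elim: u => //= b u ->; congr pair => /=; ring. Qed.

Lemma cf_act_mono u v w : v.1 <= w.1 -> v.2 <= w.2 ->
  (cf_act u v).1 <= (cf_act u w).1 /\ (cf_act u v).2 <= (cf_act u w).2.
Proof.
move=> h1 h2; elim: u => //= b u [IH1 IH2]; split=> //.
by rewrite leq_add // leq_mul2l IH2 orbT.
Qed.

Lemma cf_act_1_0 u : positive u -> (cf_act u (1, 0)).2 <= denom u.
Proof.
elim/last_ind: u => // u b _; rewrite /positive all_rcons => /andP[b0 _].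
rewrite -cats1 cf_act_cat /cf_act foldr_cat /=.
by apply: (cf_act_mono u _ _).2 => //=; rewrite !(multE, plusE) ?muln1 ?muln0 ?addn0.
Qed.

(** The left side combines the bottom row of the matrix of [u] with coefficients [cf_pair w]. Both
    row entries are at most [denom u], both coefficients at most [denom w]. *)
Lemma denom_cat u w : positive u -> positive w ->
  denom (u ++ w) <= 2 * denom u * denom w.
Proof.
move=> u0 w0; rewrite cf_act_cat.
have := cf_act_lin u (cf_pair w).1 (denom w) (1, 0) (0, 1).
rewrite /= !muln0 !muln1 addn0 -surjective_pairing => -> /=.
have h := cf_act_1_0 u0; have h2 := numer_le_denom w0.
have -> : 2 * denom u * denom w = denom w * denom u + denom w * denom u by ring.
have -> : cf_act u (0, 1) = cf_pair u by rewrite -[in RHS](cats0 u) cf_act_cat.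
by rewrite leq_add // leq_mul.
Qed.

Section Words.
Local Open Scope ring_scope.
Variables (p : nat).
Notation F := 'F_p.

Definition digit_mx (b : nat) : 'M[F]_2 := mx2 0 1 1 b%:R.
Definition word_mx (w : seq nat) := foldr (fun b M => digit_mx b *m M) 1%:M w.

Lemma word_mx_cat u w : word_mx (u ++ w) = word_mx u *m word_mx w.
Proof. by elim: u => [|b u IH] /=; rewrite ?mul1mx // IH mulmxA. Qed.

Lemma det_word_mx w : \det (word_mx w) = (-1) ^+ size w.
Proof.
elim: w => [|b w IH] /=; first by rewrite det1.
by rewrite det_mulmx IH det_mx2 mul0r mulr1 sub0r exprS.
Qed.

Lemma word_mx_col w : word_mx w *m col2 0 1 = col2 (cf_pair w).1%:R (denom w)%:R.
Proof.
elim: w => [|b w IH] /=; first by rewrite mul1mx.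
rewrite -mulmxA IH mul_mx2_col2 !(multE, plusE) natrD natrM.
by rewrite mul0r add0r !mul1r addrC.
Qed.

(** [col2 1 c] is the second column of the symmetric matrix of [c], and its transpose the second
    row; the form is thus the lower right entry of the matrix of [c w c]. *)
Lemma word_mx_form (c : nat) w :
  (col2 1 c%:R)^T *m word_mx w *m col2 1 c%:R = (denom (c :: w ++ [:: c]))%:R%:M.
Proof.
have fE : col2 1 c%:R = word_mx [:: c] *m col2 0 1.
  by rewrite /= mulmx1 mul_mx2_col2 !mul0r !mul1r !add0r mulr1.
rewrite {2}fE -mulmxA [word_mx w *m _]mulmxA -word_mx_cat word_mx_col.
apply/matrixP => i j; rewrite !ord1 !mxE !big_ord_recl big_ord0 addr0 !mxE /=.
by rewrite !(multE, plusE) natrD natrM mul1r addrC.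
Qed.

Lemma word_unit w : word_mx w \is a GRing.unit.
Proof. by rewrite -[_ \is a _]/(word_mx w \in unitmx) unitmxE det_word_mx unitrX // unitrN unitr1. Qed.

Definition word_gl w : {unit 'M[F]_2} := FinRing.unit _ (word_unit w).

Lemma word_gl_cat u w : word_gl (u ++ w) = (word_gl u * word_gl w)%g.
Proof. by apply: val_inj; rewrite /= word_mx_cat. Qed.

Lemma low_unit (x : F) : mx2 1 0 x 1 \is a GRing.unit.
Proof. by rewrite -[_ \is a _]/(mx2 1 0 x 1 \in unitmx) unitmxE det_mx2 mul1r mul0r subr0 unitr1. Qed.

Definition low x : {unit 'M[F]_2} := FinRing.unit _ (low_unit x).

Lemma lowD x y : low (x + y) = (low x * low y)%g.
Proof.
by apply: val_inj; rewrite /= [RHS]mul_mx2 !mul1r !mul0r !mulr1 !mulr0 !addr0 add0r.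
Qed.

Lemma lowN x : low (- x) = (low x)^-1%g.
Proof.
apply/eqP; rewrite eq_sym eq_invg_mul -lowD subrr.
by apply/eqP/val_inj => /=; apply/matrixP; apply: ord2_cases; apply: ord2_cases; rewrite !mxE.
Qed.
End Words.

(** When [z + b] is nonzero, the upper right entry recovers [z], the upper left [y] and the lower
    right [x]; this is the injectivity behind [card_triple_product]. *)
Lemma triple_product_mx (R : comNzRingType) (x y z b : R) : (
  mx2 1 0 x 1 *m (mx2 0 1 1 b *m mx2 1 0 z 1 *m mx2 0 1 1 b) *m mx2 1 0 y 1 =
  mx2 (1 + (z + b) * y) (z + b) (x + b + (x * (z + b) + b * z + b * b + 1) * y)
      (x * (z + b) + b * z + b * b + 1))%R.
Proof. by rewrite !mul_mx2; congr mx2; ring. Qed.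

(** Conjugation scales the unipotent parameter by [d / a]; these ratios are the multipliers of the
    pivot argument. *)
Lemma conj_low_mx (R : fieldType) (a c d x : R) : (a * d != 0 ->
  mx2 1 0 (d / a * x) 1 *m mx2 a 0 c d = mx2 a 0 c d *m mx2 1 0 x 1)%R.
Proof.
rewrite mulf_eq0 negb_or => /andP[a0 d0]; rewrite !mul_mx2; congr mx2; try ring.
by field.
Qed.

(** * Unipotent elements inside powers of a symmetric set *)

Section Growth.
Variables (p : nat) (p_pr : prime p).
Notation F := 'F_p.
Notation gT := {unit 'M[F]_2}.
Local Open Scope group_scope.

Lemma card_gl2_le : #|{: gT}| <= p ^ 4.
Proof.
have := leq_card (val : gT -> 'M[F]_2) val_inj.
by rewrite card_mx card_Fp.
Qed.

Variables (T : {set gT}).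
Hypotheses (T1 : 1 \in T) (TV : T^-1 = T).

Lemma one_pow n : 1 \in T ^+ n.
Proof.
elim: n => [|n IH]; first by rewrite expg0 inE.
by rewrite expgS -[1](mulg1 1) mem_mulg.
Qed.

Lemma pow_mono m n : m <= n -> T ^+ m \subset T ^+ n.
Proof.
move=> /subnK <-; rewrite expgD -{1}[T ^+ m]mul1g mulSg // sub1set; exact: one_pow.
Qed.

Lemma powV n : (T ^+ n)^-1 = T ^+ n.
Proof. by elim: n => [|n IH]; rewrite ?expg0 ?invg1 // {1}expgSr invMg TV IH -expgS. Qed.

(** Counting length in pairs gives the quotient of two letters level 1, and conjugation by an
    element of [T ^+ 2] raises the level by two. *)
Definition low_level n : {set F} := [set x | low x \in T ^+ n.*2].

Definition ratios : {set F} :=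
  [set ((val g : 'M[F]_2) 1 1 / (val g : 'M[F]_2) 0 0)%R
    | g : gT in [set g in T ^+ 2 | (val g : 'M[F]_2) 0%R 1%R == 0%R]].

Lemma low_level_mono n m : n <= m -> low_level n \subset low_level m.
Proof.
move=> nm; apply/subsetP => x; rewrite !inE; apply/subsetP/pow_mono.
by rewrite leq_double.
Qed.

Lemma low_levelB n m x y : x \in low_level n -> y \in low_level m ->
  (x - y)%R \in low_level (n + m).
Proof.
rewrite !inE => xn ym; rewrite lowD lowN doubleD expgD mem_mulg //.
by rewrite -powV mem_invg invgK.
Qed.

Lemma low_levelM n g x : g \in ratios -> x \in low_level n -> (g * x)%R \in low_level n.+2.
Proof.
case/imsetP => s + ->; rewrite inE => /andP[sT /eqP s01] xn; rewrite inE.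
have -> : low ((val s : 'M[F]_2) 1 1 / (val s : 'M[F]_2) 0 0 * x)%R = s * low x * s^-1.
  apply: (mulIg s); rewrite mulgKV; apply: val_inj => /=.
  have := valP s; rewrite -[_ \is a _]/(val s \in unitmx) unitmxE /=.
  move: s01; rewrite /= [FinRing.uval s]mx2E !mxE /= => ->.
  rewrite det_mx2 mul0r subr0 unitfE; exact: conj_low_mx.
have -> : n.+2.*2 = 2 + n.*2 + 2 by rewrite !doubleS addn2 add2n.
rewrite !expgD !mem_mulg //; first by rewrite inE in xn.
by rewrite -powV mem_invg invgK.
Qed.

End Growth.

(** Three unipotents of length [2 n] with two letters between them have length [6 n + 2]. The middle
    parameter avoids [- b], where injectivity fails; hence the factor [#|X|.-1]. *)
Lemma card_triple_product p (T : {set {unit 'M['F_p]_2}}) (X : {set 'F_p}) n b :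
  X \subset low_level T n -> word_gl p [:: b] \in T ->
  #|X| * #|X|.-1 * #|X| <= #|(T ^+ (6 * n).+2)%g|.
Proof.
move=> Xn bT; pose h := word_gl p [:: b].
pose f (w : 'F_p * 'F_p * 'F_p) := (low w.1.1 * (h * low w.1.2 * h) * low w.2)%g.
pose B := setX (setX X (X :\ (- b%:R)%R)) X.
have fI : {in B &, injective f}.
  move=> [[x z] y] [[x' z'] y']; rewrite !in_setX !in_setD1 /= => /andP[/andP[_ /andP[zb _]] _] _.
  move/(congr1 val); rewrite /f /= !mulmx1 -!mulmxE !triple_product_mx => /mx2_inj[].
  have zb' : (z + b%:R != 0)%R by rewrite addr_eq0.
  move=> /addrI e1 /addIr zz _; rewrite -zz in e1 *.
  by move: e1 => /(mulfI zb') -> /addIr/addIr/addIr/(mulIf zb') ->.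
have fT : f @: B \subset (T ^+ (6 * n).+2)%g.
  have -> : (6 * n).+2 = n.*2 + (1 + n.*2 + 1) + n.*2 by lia.
  have inX x : x \in X -> low x \in (T ^+ n.*2)%g by move/(subsetP Xn); rewrite inE.
  apply/subsetP => _ /imsetP[[[x z] y] + ->]; rewrite !in_setX !in_setD1 /=.
  by case/andP=> /andP[xX /andP[_ zX]] yX; rewrite !expgD expg1 !mem_mulg ?inX.
apply: leq_trans (subset_leq_card fT); rewrite (card_in_imset fI) !cardsX leq_mul2r.
apply/orP; right; rewrite leq_mul2l; apply/orP; right.
by rewrite [X in X.-1 <= _](cardsD1 (- b%:R)%R X); case: (_ \in X) => /=; rewrite ?leqnn ?leq_pred.
Qed.

(** With [s = r ^+ M], at most [p^(1/m)], one gets [x^9 <= 4^(3 M + 6) s^9 p^8], while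
    [x >= p^(1 - 2/m)]. In the [m]-th power the losses are 18 from [t] and 9 from [s], leaving
    [p^(m - 27) <= 4^((3 M + 6) m)]; this is where 27 comes from. *)
Lemma growth_numerics (p x t d m M : nat) (r : rat) :
  27 < m -> 1 < p -> p <= x * t ^ 2 -> t ^ m <= p ->
  (1 <= r)%R -> (r ^+ (m * M) <= p%:R)%R -> d ^ 3 <= 32 * p ^ 8 ->
  ((x * x.-1 * x)%:R <= 2 * (4 * r ^+ 3) ^+ M * d%:R :> rat)%R ->
  p <= 4 ^ ((3 * M + 6) * m).
Proof.
move=> m27 p1 px tp r1 rp dp xd.
have p0 : 0 < p by apply: ltnW.
have x1 : 1 < x.
  rewrite ltnNge; apply/negP => x1.
  have pt : p <= t ^ 2 by apply: leq_trans px _; case: (x) x1 => [|[|]] //; rewrite ?mul0n ?mul1n.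
  have : p ^ m <= p ^ 2.
    apply: (@leq_trans ((t ^ 2) ^ m)); first by rewrite leq_exp2r //; lia.
    by rewrite -expnM mulnC expnM leq_exp2r.
  by rewrite leq_exp2l //; lia.
have r0 : (0 <= r)%R by apply: le_trans r1.
pose s : rat := (r ^+ M)%R; have s0 : (0 <= s)%R by rewrite exprn_ge0.
have sm : (s ^+ m <= p%:R)%R by rewrite -exprM mulnC.
have h1 : ((x%:R) ^+ 3 <= 4 ^+ M.+1 * s ^+ 3 * d%:R :> rat)%R.
  have -> : (4 ^+ M.+1 * s ^+ 3 * d%:R = 2 * (2 * (4 * r ^+ 3) ^+ M * d%:R) :> rat)%R.
    by rewrite exprMn /s -!exprM [3 * M]mulnC exprS; ring.
  have : ((x%:R) ^+ 3 <= 2 * (x * x.-1 * x)%:R :> rat)%R.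
    rewrite -natrX -natrM ler_nat.
    have -> : x ^ 3 = x * x * x by rewrite !expnS expn0 muln1 mulnA.
    have -> : 2 * (x * x.-1 * x) = x * x * (2 * x.-1) by ring.
    by rewrite leq_mul2l; apply/orP; right; lia.
  move/le_trans; apply; rewrite ler_wpM2l //.
clearbody s.
have h3 : ((x%:R) ^+ 9 <= 4 ^+ (3 * M + 6) * s ^+ 9 * p%:R ^+ 8 :> rat)%R.
  have -> : ((x%:R) ^+ 9 = (x%:R ^+ 3) ^+ 3 :> rat)%R by rewrite -exprM.
  apply: (@le_trans _ _ ((4 ^+ M.+1 * s ^+ 3 * d%:R) ^+ 3)%R).
    by apply: lerXn2r; rewrite // nnegrE ?mulr_ge0 ?exprn_ge0 ?ler0n.
  have dp' : ((d%:R) ^+ 3 <= 64 * p%:R ^+ 8 :> rat)%R.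
    by rewrite -!natrX -natrM ler_nat (leq_trans dp) // leq_mul2r orbC.
  have -> : ((4 ^+ M.+1 * s ^+ 3 * d%:R) ^+ 3 = 4 ^+ (3 * M + 3) * s ^+ 9 * d%:R ^+ 3 :> rat)%R.
    have e3 : (3 * M + 3 = M.+1 * 3)%N by lia.
    by rewrite e3 exprM; ring.
  have -> : (4 ^+ (3 * M + 6) * s ^+ 9 * p%:R ^+ 8 =
    4 ^+ (3 * M + 3) * s ^+ 9 * (64 * p%:R ^+ 8) :> rat)%R.
    by rewrite (_ : 3 * M + 6 = (3 * M + 3) + 3)%N ?exprD; [ring | lia].
  by rewrite ler_wpM2l ?mulr_ge0 ?exprn_ge0.
have h4 : ((x%:R) ^+ (9 * m) <= 4 ^+ ((3 * M + 6) * m) * p%:R ^+ (9 + 8 * m) :> rat)%R.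
  rewrite exprM; apply: (@le_trans _ _ ((4 ^+ (3 * M + 6) * s ^+ 9 * p%:R ^+ 8) ^+ m)%R).
    by apply: lerXn2r; rewrite // nnegrE ?mulr_ge0 ?exprn_ge0 ?ler0n.
  have -> (a b c : rat) : ((a * b * c) ^+ m = a ^+ m * b ^+ m * c ^+ m)%R by rewrite !exprMn.
  rewrite -!exprM exprD mulrA ler_wpM2r ?exprn_ge0 ?ler0n //.
  rewrite ler_wpM2l ?exprn_ge0 // [(9 * m)%N]mulnC (exprM s m 9).
  by apply: lerXn2r; rewrite // nnegrE ?exprn_ge0 ?ler0n.
have h5 : p ^ (9 * m) <= 4 ^ ((3 * M + 6) * m) * p ^ (9 + 8 * m) * p ^ 18.
  apply: (@leq_trans ((x * t ^ 2) ^ (9 * m))); first by rewrite leq_exp2r //; lia.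
  rewrite expnMn leq_mul //; first by rewrite -(ler_nat rat) natrM !natrX.
  by rewrite -expnM (_ : 2 * (9 * m) = m * 18)%N ?expnM ?leq_exp2r //; lia.
have : p * p ^ (27 + 8 * m) <= 4 ^ ((3 * M + 6) * m) * p ^ (27 + 8 * m).
  rewrite -expnS (leq_trans (_ : _ <= p ^ (9 * m))) //; first by rewrite leq_exp2l //; lia.
  by rewrite (leq_trans h5) // -mulnA -expnD leq_mul2l leq_exp2l //; lia.
by rewrite leq_pmul2r // expn_gt0 p0.
Qed.

(** * From words to diagonal ratios *)

Section Ratios.
Variables (p : nat) (p_pr : prime p).
Notation F := 'F_p.
Notation gT := {unit 'M[F]_2}.

Lemma natFp_inj a b : a < p -> b < p -> (a%:R = b%:R :> F)%R -> a = b.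
Proof.
move=> ap bp /(congr1 (fun x : F => x : nat)).
by rewrite /= !val_Fp_nat // !modn_small.
Qed.

(** Equal slopes make [u^-1 v] send [(0, 1)] to [(0, l)], with [l] the quotient of the denominators;
    equal parity of lengths makes its determinant 1. Its diagonal is therefore [l^-1, l]. *)
Lemma ratio_of_words (T : {set gT}) (u v : seq nat) : T^-1%g = T ->
  word_gl p u \in T -> word_gl p v \in T -> odd (size u) = odd (size v) ->
  ((denom u)%:R != 0 :> F)%R ->
  ((cf_pair u).1%:R / (denom u)%:R = (cf_pair v).1%:R / (denom v)%:R :> F)%R ->
  ((denom v)%:R != 0 :> F)%R ->
  (((denom v)%:R / (denom u)%:R) ^+ 2)%R \in ratios T.
Proof.
move=> TV uT vT uv qu e qv; pose s := ((word_gl p u)^-1 * word_gl p v)%g.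
have sE : (word_mx p u *m val s = word_mx p v)%R.
  exact: (congr1 val (mulKVg (word_gl p u) (word_gl p v))).
pose l : F := ((denom v)%:R / (denom u)%:R)%R.
have Mu : word_mx p u \in unitmx := word_unit p u.
have sc : (val s *m col2 0 1 = col2 0 l)%R.
  apply: (can_inj (mulKmx Mu)); rewrite mulmxA sE word_mx_col.
  have -> : (col2 0 l = l *: col2 0 1 :> 'cV[F]_2)%R.
    by apply/matrixP => i j; elim/ord2_cases: i; rewrite !mxE /= ?mulr0 ?mulr1.
  rewrite -scalemxAr word_mx_col; apply/matrixP => i j; elim/ord2_cases: i; rewrite !mxE /=.
    by rewrite /l mulrAC -mulrA e mulrCA mulfV // mulr1.
  by rewrite /l mulfVK.
have ds : (\det (val s) = 1)%R.
  have := congr1 (fun M => \det M)%R sE; rewrite det_mulmx !det_word_mx.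
  rewrite -signr_odd uv signr_odd => h; apply: (mulfI (_ : (-1) ^+ size v != 0 :> F)%R).
    by rewrite signr_eq0.
  by rewrite mulr1.
have sT : s \in (T ^+ 2)%g by rewrite expgS expg1 mem_mulg // -TV mem_invg invgK.
have [s01 s11] : (val s : 'M[F]_2) 0%R 1%R = 0%R /\ (val s : 'M[F]_2) 1%R 1%R = l.
  move: sc; rewrite {1}(mx2E (val s)) mul_mx2_col2 !mulr0 !mulr1 !add0r.
  by move/col2_inj.
apply/imsetP; exists s; first by rewrite inE sT s01 eqxx.
rewrite (mx2E (val s)) det_mx2 s01 mul0r subr0 s11 in ds.
have l0 : l != 0%R by apply: contra_eq_neq ds => ->; rewrite mulr0 eq_sym oner_neq0.
have s00 : ((val s : 'M[F]_2) 0 0 = l^-1)%R by apply: (mulIf l0); rewrite ds mulVf.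
by rewrite s00 s11 invrK expr2.
Qed.

Lemma card_square_fiber (y : F) : #|[set l : F | l ^+ 2 == y]%R| <= 2.
Proof.
pose P : {poly F} := ('X^2 - y%:P)%R.
have sP : size P = 3 by rewrite size_XnsubC.
have := @max_poly_roots _ P (enum [set l : F | l ^+ 2 == y]%R).
rewrite sP ltnS -cardE; apply; last exact: enum_uniq.
  by rewrite -size_poly_eq0 sP.
by apply/allP => l; rewrite mem_enum inE rootE !hornerE subr_eq0.
Qed.

(** The factor [4 * p] accounts for [p] slopes, two parities of length and two-to-one squaring.
    Within a class the denominators stay distinct modulo [p]: slope and denominator determine the
    column, whose entries are below [p]. *)
Lemma card_ratios (T : {set gT}) (ws : seq (seq nat)) : T^-1%g = T -> uniq ws ->
  {in ws &, injective cf_pair} ->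
  {in ws, forall w, [/\ positive w, denom w < p & word_gl p w \in T]} ->
  size ws <= 4 * p * #|ratios T|.
Proof.
move=> TV uws inj wsP; case: (posnP (size ws)) => [->//|N0].
pose w (i : 'I_(size ws)) := nth [::] ws i.
have win i : w i \in ws by rewrite mem_nth.
have wI : injective w.
  by move=> i j /eqP; rewrite nth_uniq // => /eqP/val_inj.
pose qr i : F := ((denom (w i))%:R)%R.
pose f i : F * bool := ((cf_pair (w i)).1%:R / qr i, odd (size (w i)))%R.
have := @pigeonhole _ _ f; rewrite card_ord => /(_ N0)[[rho par]].
rewrite card_prod card_Fp // card_bool; set B := [set x | _] => NB.
have [B0|[i0 i0B]] := set_0Vmem B; first by move: NB; rewrite B0 cards0 muln0 leqNgt N0.
have BP i : i \in B -> ((cf_pair (w i)).1%:R / qr i)%R = rho /\ odd (size (w i)) = par.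
  by rewrite inE => /eqP[<- <-].
have qr0 i : qr i != 0%R.
  have [wp wl _] := wsP _ (win i); have := denom_gt0 wp.
  by rewrite lt0n; apply: contraNneq => /(@natFp_inj _ 0) ->; rewrite // prime_gt0.
have qI : {in B &, injective qr}.
  move=> i j iB jB qij; apply/wI/inj => //.
  have [ri _] := BP _ iB; have [rj _] := BP _ jB.
  have [wpi wli _] := wsP _ (win i); have [wpj wlj _] := wsP _ (win j).
  rewrite [LHS]surjective_pairing [RHS]surjective_pairing; congr pair; last exact: natFp_inj qij.
  apply: natFp_inj; try by apply: leq_ltn_trans (numer_le_denom _) _.
  by move: rj; rewrite -ri qij => /(mulIf (invr_neq0 (qr0 j))).
pose h i := ((qr i / qr i0) ^+ 2)%R.
have hB : #|B| <= 2 * #|h @: B|.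
  apply: leq_card_fiber => y.
  apply: leq_trans (card_square_fiber y).
  rewrite -(card_in_imset (f := fun i => (qr i / qr i0)%R)); last first.
    move=> i j; rewrite !inE => /andP[iB _] /andP[jB _] /(mulIf (invr_neq0 (qr0 i0))).
    by apply: qI; rewrite inE.
  by apply/subset_leq_card/subsetP => _ /imsetP[i + ->]; rewrite !inE => /andP[_].
have hT : #|h @: B| <= #|ratios T|.
  apply/subset_leq_card/subsetP => _ /imsetP[i iB ->].
  have [ri pi] := BP _ iB; have [r0 p0] := BP _ i0B.
  have [_ _ wT] := wsP _ (win i); have [_ _ w0T] := wsP _ (win i0).
  by apply: ratio_of_words; rewrite ?pi ?p0 //; [exact: qr0 | rewrite [LHS]r0 -ri | exact: qr0].
apply: leq_trans NB _; rewrite (_ : 4 * p = p * 2 * 2); last by lia.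
by rewrite -[leqRHS]mulnA leq_mul // (leq_trans hB) // leq_mul2l.
Qed.
End Ratios.

(** Here [t] is the integer part of the [m]-th root of [p]. It is at least [2 ^ m], so
    [p < (t + 1)^m <= (2 t)^m <= t^(m + 1)]. *)
Lemma exponent_root (p m : nat) : 0 < p -> 0 < m -> 2 ^ (m * m) <= p ->
  exists t, t ^ m <= p < t ^ m.+1.
Proof.
move=> p0 m0 pm.
have ex0 : exists t, t ^ m <= p by exists 0; rewrite exp0n.
have ub t : t ^ m <= p -> t <= p.
  by move=> tm; apply: leq_trans tm; case: t => // t; rewrite -{1}[t.+1]expn1 leq_pexp2l.
have [t tm tmax] := ex_maxnP ex0 ub; exists t; rewrite tm /=.
have t2 : 2 ^ m <= t by apply: tmax; rewrite -expnM.
have : p < t.+1 ^ m by rewrite ltnNge; apply/negP => /tmax; rewrite ltnn.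
move/leq_trans; apply; rewrite expnS; apply: (@leq_trans ((2 * t) ^ m)).
  have t0 : 0 < t by apply: leq_trans t2; rewrite expn_gt0.
  by rewrite leq_exp2r // mul2n -addnn -addn1 leq_add2l.
by rewrite expnMn leq_mul2r t2 orbT.
Qed.

(** * Bounded products of words and the hit modulo [p] *)

Section Words.
Variables (A : seq nat) (p : nat) (p_pr : prime p).
Notation gT := {unit 'M['F_p]_2}.
Hypotheses (A0 : positive A) (Ap : {in A, forall b, b < p}).
Variable ws : seq (seq nat).
Hypotheses (wsA : {in ws, forall w, all (mem A) w}) (wsp : {in ws, forall w, denom w < p}).

Definition base_words : seq (seq nat) := [::] :: ws ++ [seq [:: b] | b <- A].
Definition base_set : {set gT} := [set g in [seq word_gl p w | w <- base_words]].

Lemma word_positive w : all (mem A) w -> positive w.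
Proof. by move=> /allP wA; apply/allP => b /wA; move/allP: A0; apply. Qed.

Lemma base_setP g : reflect (exists2 w, w \in base_words & g = word_gl p w) (g \in base_set).
Proof. by rewrite inE; apply: (iffP mapP). Qed.

Lemma base_words_ok w : w \in base_words -> all (mem A) w /\ denom w < p.
Proof.
rewrite !inE mem_cat => /or3P[/eqP->|wW|/mapP[b bA ->]] /=.
- by rewrite prime_gt1.
- by rewrite wsA // wsp.
by rewrite bA /= !(multE, plusE) muln1 addn0 Ap.
Qed.

(** Concatenation costs a factor 2 in the denominator, so [2 * denom] is the submultiplicative
    quantity. *)
Lemma base_set_pow k g : g \in (base_set ^+ k.+1)%g ->
  exists w, [/\ all (mem A) w, g = word_gl p w & 2 * denom w <= (2 * p) ^ k.+1].
Proof.
elim: k g => [|k IH] g.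
  rewrite expg1 => /base_setP[w /base_words_ok[wA wp] ->]; exists w; split=> //.
  by rewrite expn1 leq_mul2l ltnW.
rewrite expgSr => /mulsgP[g1 g2 /IH[u [uA -> up]] /base_setP[w /base_words_ok[wA wp] ->] ->].
exists (u ++ w); rewrite all_cat uA wA word_gl_cat; split=> //.
apply: (@leq_trans ((2 * denom u) * (2 * denom w))).
  rewrite -mulnA leq_mul2l /= mulnCA mulnA; exact: denom_cat (word_positive uA) (word_positive wA).
by rewrite expnSr leq_mul // leq_mul2l ltnW.
Qed.

End Words.

(** The size condition reads [size ws >= 4 p^(1 + 1/m)], so [card_ratios] provides at least
    [p^(1/m)] multipliers. The letters [b1] and [b2] supply the starting unipotent element. *)
Theorem modular_hit (A : seq nat) (b1 b2 c m : nat) :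
  positive A -> b1 \in A -> b2 \in A -> b2 < b1 -> c \in A -> 27 < m ->
  exists p0 C, forall p, prime p -> p0 <= p -> forall ws : seq (seq nat),
    uniq ws -> {in ws, forall w, all (mem A) w} -> {in ws, forall w, denom w < p} ->
    {in ws &, injective cf_pair} -> (4 * p) ^ m * p <= size ws ^ m ->
  exists w, [/\ all (mem A) w, p %| denom (c :: w ++ [:: c])
     & denom (c :: w ++ [:: c]) <= (2 * p) ^ C].
Proof.
move=> A0 b1A b2A b12 cA m27.
(* [T ^+ M.+1] is the power holding the triple products from level [n], and [L] makes the tripling
   constant satisfy [r ^+ (m * M) <= p]. *)
pose n := pivot_level m.+1; pose M := 6 * n + 1; pose L := m * M.
pose B := 4 ^ ((3 * M + 6) * m).
(* The summands put all letters below [p], allow [exponent_root], and make [p] exceed the bound of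
   [growth_numerics]. The exponent counts three products of at most [3 ^ (4 * L)] base words and two
   letters [c]. *)
exists (sumn A + 2 ^ (m * m) + B).+1, (3 * 3 ^ (4 * L) + 2) => p p_pr p0 ws uws wsA wsp inj big.
have p1 := prime_gt1 p_pr; have m0 : 0 < m by apply: ltn_trans m27.
have p_gt0 := ltnW p1.
have Ap : {in A, forall b, b < p}.
  move=> b bA; apply: leq_trans p0; rewrite ltnS -addnA (leq_trans _ (leq_addr _ _)) //.
  by elim: (A) bA => //= a l IH; rewrite inE => /orP[/eqP->|/IH]; [exact: leq_addr | move=> h;
    apply: leq_trans h (leq_addl _ _)].
have [t /andP[tp pt]] : exists t, t ^ m <= p < t ^ m.+1.
  apply: exponent_root => //.
  apply: leq_trans (ltnW p0); rewrite addnAC; exact: leq_addl.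
pose D0 : {set {unit 'M['F_p]_2}} := base_set A p ws.
have D0w w : w \in base_words A ws -> word_gl p w \in D0 by move=> wW; apply/base_setP; exists w.
have D01 : 1%g \in D0.
  have -> : 1%g = word_gl p [::] by apply: val_inj.
  by apply: D0w; rewrite inE eqxx.
have L0 : 0 < L by rewrite muln_gt0 m0 /M addn1.
have [j jL hj] := tripling_scale D01 (card_gl2_le p_pr) p1 L0.
pose D := (D0 ^+ (3 ^ j))%g; pose T := symset D.
have D0D : D0 \subset D.
  rewrite -[D0]expg1; apply: (pow_mono D01); by rewrite expn_gt0.
have D1 : 1%g \in D by apply: (subsetP D0D).
have DDD : (D * D * D)%g = (D0 ^+ (3 ^ j.+1))%g.
  by rewrite /D -!expgD expnS; rewrite !mulSn mul0n addn0 addnA.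
have DT : D \subset T by rewrite subsetUl.
have T1 : 1%g \in T by apply: (subsetP DT).
have TV : (T^-1)%g = T by rewrite /T /symset invUg invgK setUC.
have wT w : w \in base_words A ws -> word_gl p w \in T.
  by move=> /D0w/(subsetP D0D)/(subsetP DT).
have lT b : b \in A -> word_gl p [:: b] \in T.
  by move=> bA; apply: wT; rewrite inE mem_cat map_f ?orbT.
have cG : t <= #|ratios T|.
  have cr : size ws <= 4 * p * #|ratios T|.
    apply: card_ratios => // w wW; split; first exact: word_positive (wsA _ wW).
    - exact: wsp.
    by apply: wT; rewrite inE mem_cat wW orbT.
  rewrite -(@leq_exp2r _ _ m) //.
  apply: leq_trans tp _; rewrite -(@leq_pmul2l ((4 * p) ^ m));
    last by rewrite expn_gt0 muln_gt0 p_gt0.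
  by rewrite -expnMn (leq_trans big) // leq_exp2r.
pose x0 : 'F_p := (b1 - b2)%:R%R.
have x0N : x0 != 0%R.
  apply/eqP => /(@natFp_inj _ p_pr (b1 - b2) 0).
  move/(_ (leq_ltn_trans (leq_subr _ _) (Ap _ b1A)) p_gt0)/eqP.
  by rewrite subn_eq0 leqNgt b12.
have x0l : x0 \in low_level T 1.
  rewrite inE; have -> : low x0 = (word_gl p [:: b1] * (word_gl p [:: b2])^-1)%g.
    apply: (mulIg (word_gl p [:: b2])); rewrite mulgKV; apply: val_inj => /=.
    rewrite !mulmx1 -mulmxE [LHS]mul_mx2 !mul1r !mul0r mulr0 !mulr1 !addr0 add0r.
    by rewrite /x0 natrB 1?ltnW // subrK.
  by rewrite -[1.*2]/2 expgS expg1 mem_mulg ?lT // -TV mem_invg invgK lT.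
have Fgen (y : 'F_p) : exists k, (y = k%:R)%R by exists y; rewrite natr_Zp.
have ptF : #|'F_p| < t ^ m.+1 by rewrite card_Fp.
have [X Xl pX] := pivot_growth Fgen x0N x0l (low_levelB TV) (low_levelM TV)
   (low_level_mono T1) cG ptF.
rewrite card_Fp // -/n in pX Xl.
have XT := card_triple_product Xl (lT _ cA).
pose r : rat := ((#|(D * D * D)%g|)%:R / (#|D|)%:R)%R.
have D0' : 0 < #|D| by rewrite card_gt0; apply/set0Pn; exists 1%g.
have Dr : (0 < #|D|%:R :> rat)%R by rewrite ltr0n.
have rD : ((#|(D * D * D)%g|)%:R <= r * (#|D|)%:R :> rat)%R by rewrite mulfVK ?gt_eqF.
have r1 := tripling_ge1 D1 rD.
have rp : (r ^+ L <= p%:R)%R.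
  rewrite expr_div_n ler_pdivrMr ?exprn_gt0 // -!natrX -natrM ler_nat DDD.
  exact: hj.
have TM := card_symset_pow D1 rD M.
have XT' : ((#|X| * #|X|.-1 * #|X|)%:R <= 2 * (4 * r ^+ 3) ^+ M * #|D|%:R :> rat)%R.
  by apply: le_trans TM; rewrite ler_nat (leq_trans XT) // /M addn1.
have big3 : 32 * p ^ 8 < #|D| ^ 3.
  rewrite ltnNge; apply/negP => dp.
  have := growth_numerics m27 p1 pX tp r1 rp dp XT'; rewrite -/B => pB.
  by have := leq_ltn_trans (leq_addl _ B) p0; rewrite ltnNge pB.
pose DM : {set 'M['F_p]_2} := [set val g | g in D].
have Dw g : g \in D -> exists w, [/\ all (mem A) w, g =
  word_gl p w & 2 * denom w <= (2 * p) ^ (3 ^ j)].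
  have -> : 3 ^ j = (3 ^ j).-1.+1 by rewrite prednK // expn_gt0.
  by rewrite /D -{1}[3 ^ j]prednK ?expn_gt0 //; apply: base_set_pow.
have dM : {in DM, forall N, \det N ^+ 2 = 1}%R.
  move=> _ /imsetP[g /Dw[w [_ -> _]] ->]; rewrite /= det_word_mx.
  by rewrite sqrr_sign.
have bigM : 32 * #|'F_p| ^ 8 < #|DM| ^ 3 by rewrite card_Fp // card_imset //; exact: val_inj.
have [_ [_ [_ [/imsetP[g1 g1D ->] /imsetP[g2 g2D ->] /imsetP[g3 g3D ->]]]]] :=
  three_fold_hit c%:R%R dM bigM.
have [w1 [w1A -> h1]] := Dw _ g1D; have [w2 [w2A -> h2]] := Dw _ g2D.
have [w3 [w3A -> h3]] := Dw _ g3D => e.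
exists (w1 ++ w2 ++ w3); split; first by rewrite !all_cat w1A w2A w3A.
  rewrite (dvdn_pcharf (pchar_Fp p_pr)); move: (word_mx_form p c (w1 ++ w2 ++ w3)).
  rewrite !word_mx_cat; move: e; rewrite /= !mulmxA => ->.
  by move/matrixP/(_ 0%R 0%R); rewrite !mxE eqxx mulr1n => /esym ->.
have cA' : all (mem A) [:: c] by rewrite /= cA.
have pos := word_positive A0.
have cat2 u v : all (mem A) u -> all (mem A) v -> 2 * denom (u ++ v) <= 2 * denom u * (2 * denom v).
  move=> uA vA; rewrite -mulnA leq_mul2l /= mulnCA mulnA.
  exact: denom_cat (pos _ uA) (pos _ vA).
have c1 : 2 * denom [:: c] <= (2 * p) ^ 1.
  by rewrite expn1 leq_mul2l /= !(multE, plusE) muln1 addn0 ltnW ?Ap.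
have step u v k l : all (mem A) u -> all (mem A) v -> 2 * denom u <= (2 * p) ^ k ->
    2 * denom v <= (2 * p) ^ l -> 2 * denom (u ++ v) <= (2 * p) ^ (k + l).
  by move=> uA vA uk vl; rewrite expnD (leq_trans (cat2 _ _ uA vA)) // leq_mul.
have h : 2 * denom ([:: c] ++ ((w1 ++ w2 ++ w3) ++ [:: c])) <= (2 * p) ^ (1 + ((3 ^ j + (3 ^ j + 3 ^ j)) + 1)).
  have w23A : all (mem A) (w2 ++ w3) by rewrite all_cat w2A.
  have wA : all (mem A) (w1 ++ w2 ++ w3) by rewrite all_cat w1A.
  apply: (step _ _ _ _ _ _ c1 _) => //; first by rewrite all_cat wA.
  apply: (step _ _ _ _ _ _ _ c1) => //; apply: (step _ _ _ _ _ _ h1 _) => //.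
  exact: (step _ _ _ _ _ _ h2 h3).
apply: leq_trans (leq_pmull _ (isT : 0 < 2)) _; apply: leq_trans h _.
rewrite leq_pexp2l //; first by rewrite muln_gt0.
have : 3 ^ j <= 3 ^ (4 * L) by rewrite leq_exp2l // ltnW.
by move: (3 ^ j) (3 ^ (4 * L)) => a b; clear; lia.
Qed.

(** * Transfer to standard lists, divisibility and primes *)

Lemma inP (T : eqType) (x : T) (s : seq T) : reflect (List.In x s) (x \in s).
Proof.
elim: s => [|y s IH] /=; first by constructor.
rewrite inE; apply: (iffP orP) => -[]; first by move/eqP=> ->; left.
- by move/IH; right.
- by move=> ->; left.
by move/IH; right.
Qed.

Lemma NoDup_uniq (T : eqType) (s : seq T) : List.NoDup s -> uniq s.
Proof. by elim=> //= x l /inP -> _ ->. Qed.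

Lemma pow_expn a n : Nat.pow a n = a ^ n.
Proof. by elim: n => //= n ->; rewrite expnS. Qed.

Lemma Zprime_prime p : Znumtheory.prime (BinInt.Z.of_nat p) -> prime p.
Proof.
move=> pp; have p1 := Znumtheory.prime_ge_2 _ pp.
apply/primeP; split; first by lia.
move=> d /dvdnP[k kd]; have : BinInt.Z.divide (BinInt.Z.of_nat d) (BinInt.Z.of_nat p).
  by exists (BinInt.Z.of_nat k); lia.
by move/(Znumtheory.prime_divisors _ pp) => h; apply/orP; lia.
Qed.

(** If [k] is the order of the matrix of [c], the word of [k] letters [c] has numerator 0 modulo
    [p], and this numerator is the denominator of the word with [k - 1] letters. *)
Lemma denom_dvd_power p c : prime p -> exists n, p %| denom (nseq n c).
Proof.
move=> p_pr; pose g := word_gl p [:: c]; exists #[g]%g.-1.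
have gn n : word_gl p (nseq n c) = (g ^+ n)%g.
  elim: n => [|n IH]; first exact: val_inj.
  by rewrite expgS -IH -word_gl_cat.
have : word_mx p (nseq #[g]%g c) = 1%:M%R.
  by have := congr1 val (gn #[g]%g); rewrite expg_order.
move/(congr1 (mulmx^~ (col2 0 1))%R); rewrite mul1mx word_mx_col => /col2_inj[e _].
rewrite (dvdn_pcharf (pchar_Fp p_pr)); move: e.
by rewrite -{1}[#[g]%g]prednK ?order_gt0 //= => ->.
Qed.

Lemma all_memP (A w : seq nat) : (forall b, List.In b w -> List.In b A) <-> all (mem A) w.
Proof.
by split=> [h|/allP h b /inP/h/inP //]; apply/allP => b /inP/h/inP.
Qed.

Theorem modular_hit_list (A : list nat) (b1 b2 c m : nat) :
  (forall k, List.In k A -> (1 <= k)%coq_nat) ->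
  List.In b1 A -> List.In b2 A -> (b2 < b1)%coq_nat -> List.In c A -> (28 <= m)%coq_nat ->
  exists p0 C, forall p, Znumtheory.prime (BinInt.Z.of_nat p) -> (p0 <= p)%coq_nat ->
  forall ws : list (list nat), List.NoDup ws ->
    (forall w, List.In w ws -> forall b, List.In b w -> List.In b A) ->
    (forall w, List.In w ws -> (denom w < p)%coq_nat) ->
    (forall u v, List.In u ws -> List.In v ws -> cf_pair u = cf_pair v -> u = v) ->
    (Nat.mul (Nat.pow (Nat.mul 4 p) m) p <= Nat.pow (length ws) m)%coq_nat ->
  exists w, [/\ forall b, List.In b w -> List.In b A,
    PeanoNat.Nat.divide p (denom (c :: List.app w (c :: nil))) &
    (denom (c :: List.app w (c :: nil)) <= Nat.pow (Nat.mul 2 p) C)%coq_nat].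
Proof.
move=> A0 /inP b1A /inP b2A /ssrnat.ltP b12 /inP cA /ssrnat.leP m28.
have Apos : positive A by apply/allP => k /inP/A0/ssrnat.leP.
have [p0 [C hit]] := modular_hit Apos b1A b2A b12 cA m28.
exists p0, C => p /Zprime_prime p_pr /ssrnat.leP p0p ws /NoDup_uniq uws wsA wsp inj /ssrnat.leP big.
have [||||w [wA pw wC]] := hit p p_pr p0p ws uws.
- by move=> w /inP/wsA/all_memP.
- by move=> w /inP/wsp/ssrnat.ltP.
- by move=> u v /inP uW /inP vW; apply: inj.
- by move: big; rewrite !pow_expn.
exists w; split; [exact/all_memP | | by apply/ssrnat.leP; rewrite pow_expn].
by case/dvdnP: pw => k ->; exists k.
Qed.

Lemma denom_divide_repeat (p c : nat) : Znumtheory.prime (BinInt.Z.of_nat p) ->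
  exists n, PeanoNat.Nat.divide p (denom (List.repeat c n)).
Proof.
move=> /Zprime_prime p_pr; have [n /dvdnP[k e]] := denom_dvd_power c p_pr.
by exists n, k; rewrite (_ : List.repeat c n = nseq n c) ?e //; elim: (n) => //= i ->.
Qed.

Lemma denom_app (u w : list nat) : (forall k, List.In k u -> (1 <= k)%coq_nat) ->
  (forall k, List.In k w -> (1 <= k)%coq_nat) ->
  (denom (List.app u w) <= Nat.mul (Nat.mul 2 (denom u)) (denom w))%coq_nat.
Proof.
move=> u0 w0; apply/ssrnat.leP; apply: denom_cat.
  by apply/allP => k /inP/u0/ssrnat.leP.
by apply/allP => k /inP/w0/ssrnat.leP.
Qed.

End ModularHit.

Require Import Defs.
From Stdlib Require Import Reals Lra Lia ZArith Znumtheory List FinFun Arith Classical.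
From Coquelicot Require Import Coquelicot.
Open Scope R_scope.

(** * Continued fraction expansions *)

(** [cf_pair] with a real tail [y] in place of 0: homogeneous coordinates of [mob w y], which keep
    the determinant identity free of divisions. *)
Fixpoint mob_frac (w : list nat) (y : R) : R * R :=
  match w with
  | nil => (y, 1)
  | b :: w' => (snd (mob_frac w' y), INR b * snd (mob_frac w' y) + fst (mob_frac w' y))
  end.

Definition mob (w : list nat) (y : R) : R := fold_right (fun b z => / (INR b + z)) y w.

Definition pos_word (w : list nat) := forall b, In b w -> (1 <= b)%nat.

Lemma pos_word_cons b w : pos_word (b :: w) -> (1 <= b)%nat /\ pos_word w.
Proof. intros H; split; [apply H; now left | intros k Hk; apply H; now right]. Qed.

Lemma mob_frac_bounds w y : pos_word w -> 0 <= y ->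
  INR (fst (cf_pair w)) <= fst (mob_frac w y) /\ INR (denom w) <= snd (mob_frac w y).
Proof.
intros Hw Hy; induction w as [|b w IH]; simpl; [lra|].
destruct (pos_word_cons _ _ Hw) as [Hb Hw']; destruct (IH Hw') as [H1 H2].
split; [exact H2|]; rewrite plus_INR, mult_INR.
apply Rplus_le_compat; [|exact H1].
apply Rmult_le_compat_l; [apply pos_INR | exact H2].
Qed.

Lemma length_le_denom w : pos_word w -> (length w <= denom w)%nat /\ (1 <= denom w)%nat /\
  (w <> nil -> 1 <= fst (cf_pair w))%nat.
Proof.
induction w as [|b w IH]; intros Hw; simpl; [now repeat split; try lia|].
destruct (pos_word_cons _ _ Hw) as [Hb Hw']; destruct (IH Hw') as [H1 [H2 H3]].
assert (denom w <= b * denom w)%nat by nia.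
repeat split; try lia; destruct w as [|a w]; [simpl in *; lia|].
assert (1 <= fst (cf_pair (a :: w)))%nat by now apply H3.
simpl length in *; lia.
Qed.

(** Each letter has determinant -1 and only flips the sign. As both denominators are at least
    [denom w], this gives the diameter of a cylinder. *)
Lemma mob_frac_det w y z :
  Rabs (fst (mob_frac w y) * snd (mob_frac w z) - fst (mob_frac w z) * snd (mob_frac w y))
  = Rabs (y - z).
Proof.
induction w as [|b w IH]; simpl; [f_equal; ring|].
rewrite <- IH, <- Rabs_Ropp; f_equal; ring.
Qed.

Lemma mob_fracE w y : pos_word w -> 0 <= y -> mob w y = fst (mob_frac w y) / snd (mob_frac w y).
Proof.
intros Hw Hy; induction w as [|b w IH]; [unfold mob; simpl; field|].
change (mob (b :: w) y) with (/ (INR b + mob w y)); simpl mob_frac; simpl fst; simpl snd.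
destruct (pos_word_cons _ _ Hw) as [Hb Hw'].
rewrite IH by exact Hw'.
destruct (mob_frac_bounds w y Hw' Hy) as [H1 H2].
destruct (length_le_denom w Hw') as [_ [H3 _]].
assert (1 <= INR (denom w)) by (apply (le_INR 1); exact H3).
assert (1 <= INR b) by (apply (le_INR 1); exact Hb).
assert (0 <= INR (fst (cf_pair w))) by apply pos_INR.
field; split; nra.
Qed.

Lemma mob_diam w y z : pos_word w -> 0 <= y <= 1 -> 0 <= z <= 1 ->
  Rabs (mob w y - mob w z) <= / (INR (denom w) * INR (denom w)).
Proof.
intros Hw Hy Hz; rewrite !mob_fracE by (easy || lra).
destruct (mob_frac_bounds w y Hw) as [_ Hy2]; [lra|].
destruct (mob_frac_bounds w z Hw) as [_ Hz2]; [lra|].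
assert (Hd := mob_frac_det w y z).
destruct (length_le_denom w Hw) as [_ [H3 _]].
assert (H1 : 1 <= INR (denom w)) by (apply (le_INR 1); exact H3).
set (a := fst (mob_frac w y)) in *; set (b := snd (mob_frac w y)) in *.
set (c := fst (mob_frac w z)) in *; set (d := snd (mob_frac w z)) in *.
replace (a / b - c / d) with ((a * d - c * b) * / (b * d)) by (field; lra).
assert (0 < b * d) by nra.
rewrite Rabs_mult, Hd, (Rabs_pos_eq (/ (b * d))) by (left; now apply Rinv_0_lt_compat).
assert (Hyz : Rabs (y - z) <= 1) by (apply Rabs_le; lra).
apply Rle_trans with (1 * / (b * d)).
- apply Rmult_le_compat_r; [left; now apply Rinv_0_lt_compat | exact Hyz].
- rewrite Rmult_1_l; apply Rinv_le_contravar; nra.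
Qed.

Definition digits (n : nat) (x : R) : list nat :=
  map (fun i => Z.to_nat (cf_digit i x)) (seq 0 n).

Lemma digits_succ n x : digits (S n) x = digits n x ++ (Z.to_nat (cf_digit n x) :: nil).
Proof. unfold digits; rewrite seq_S, map_app; reflexivity. Qed.

Lemma gauss_map_bounds r : 0 <= gauss_map r <= 1.
Proof. unfold gauss_map; destruct (base_Int_part (/ r)); lra. Qed.

Section Expansion.
Variables (A : list nat) (x : R).
Hypothesis A1 : forall k, In k A -> (1 <= k)%nat.
Hypothesis xA : F_set A x.

Lemma digits_in n k : In k (digits n x) -> In k A.
Proof.
unfold digits; rewrite in_map_iff; intros [i [<- _]].
destruct xA as [_ [_ H]]; destruct (H i) as [k [Hk ->]]; now rewrite Nat2Z.id.
Qed.

Lemma gauss_step n :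
  0 <= Nat.iter n gauss_map x <= 1 /\
  Nat.iter n gauss_map x = / (INR (Z.to_nat (cf_digit n x)) + Nat.iter (S n) gauss_map x) /\
  0 <= Nat.iter (S n) gauss_map x <= 1.
Proof.
assert (Hx : 0 <= Nat.iter n gauss_map x <= 1).
{ destruct n as [|n]; [now destruct xA | apply gauss_map_bounds]. }
split; [exact Hx|]; change (Nat.iter (S n) gauss_map x) with (gauss_map (Nat.iter n gauss_map x)).
split; [|apply gauss_map_bounds].
destruct xA as [_ [_ H]]; destruct (H n) as [k [Hk E]]; rewrite E, Nat2Z.id.
unfold cf_digit in E; unfold gauss_map at 2; rewrite E, <- INR_IZR_INZ.
set (r := Nat.iter n gauss_map x).
replace (INR k + (/ r - INR k)) with (/ r) by ring; now rewrite Rinv_inv.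
Qed.

Lemma expansion n : x = mob (digits n x) (Nat.iter n gauss_map x).
Proof.
induction n as [|n IH]; [reflexivity|].
rewrite digits_succ; unfold mob in *; rewrite fold_right_app; simpl fold_right at 2.
rewrite IH at 1; f_equal; apply gauss_step.
Qed.
End Expansion.

(** * Hausdorff dimension and finite covers *)

Lemma Rbar_glb_correct P : Rbar_is_glb P (Rbar_glb P).
Proof. unfold Rbar_glb; now destruct (Rbar_ex_glb P). Qed.

Lemma Rbar_lub_correct P : Rbar_is_lub P (Rbar_lub P).
Proof. unfold Rbar_lub; now destruct (Rbar_ex_lub P). Qed.

Lemma diam_pow_nonneg s U : 0 <= diam_pow s U.
Proof.
unfold diam_pow; destruct (diam U); try lra.
destruct (Rle_dec r 0); [destruct (Req_EM_T s 0); lra|].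
left; apply exp_pos.
Qed.

Lemma sum_n_nonneg (f : nat -> R) n : (forall i, 0 <= f i) -> 0 <= sum_n f n.
Proof.
intros Hf; induction n as [|n IH]; [rewrite sum_O; apply Hf|].
rewrite sum_Sn; unfold plus; simpl; specialize (Hf (S n)); lra.
Qed.

(** Below the dimension the measure is nonzero, so the content is positive at some scale [rho]; its
    value, when finite, serves as [eta]. *)
Lemma hausdorff_lower s E : 0 <= s -> Rbar_lt (Finite s) (hausdorff_dim E) ->
  exists rho eta, 0 < rho /\ 0 < eta /\
  forall (U : nat -> R -> Prop) (M : R),
    (forall x, E x -> exists i, U i x) ->
    (forall i, Rbar_le (diam (U i)) (Finite rho)) ->
    (forall n, sum_n (fun i => diam_pow s (U i)) n <= M) -> eta <= M.
Proof.
intros Hs Hdim.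
assert (Hm : hausdorff_measure s E <> Finite 0).
{ intros H0; unfold hausdorff_dim in Hdim.
  set (P := fun t => exists s, t = Finite s /\ 0 <= s /\ hausdorff_measure s E = Finite 0) in Hdim.
  destruct (Rbar_glb_correct P) as [Hlb _].
  apply (Rbar_lt_not_le _ _ Hdim); apply Hlb; now exists s. }
assert (Hpos : forall d, Rbar_le (Finite 0) (hausdorff_delta s d E)).
{ intros d; unfold hausdorff_delta.
  match goal with |- Rbar_le _ (Rbar_glb ?P) => destruct (Rbar_glb_correct P) as [_ Hg] end.
  apply Hg; intros v [U [_ [_ ->]]]; unfold sum_Rbar.
  match goal with |- Rbar_le _ (Rbar_lub ?P) => destruct (Rbar_lub_correct P) as [Hu _] end.
  apply Rbar_le_trans with (Finite (sum_n (fun i => diam_pow s (U i)) 0)).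
  - simpl; apply sum_n_nonneg; intros; apply diam_pow_nonneg.
  - apply Hu; now exists 0%nat. }
destruct (classic (exists d, 0 < d /\
  Rbar_lt (Finite 0) (hausdorff_delta s d E))) as [[d [Hd Hlt]]|Hno].
- assert (Hle : forall (U : nat -> R -> Prop) (M : R),
    (forall x, E x -> exists i, U i x) ->
    (forall i, Rbar_le (diam (U i)) (Finite d)) ->
    (forall n, sum_n (fun i => diam_pow s (U i)) n <= M) ->
    Rbar_le (hausdorff_delta s d E) (Finite M)).
  { intros U M HU Hdi HM; apply Rbar_le_trans with (sum_Rbar (fun i => diam_pow s (U i))).
    - unfold hausdorff_delta.
      match goal with |- Rbar_le (Rbar_glb ?P) _ => destruct (Rbar_glb_correct P) as [Hlb _] end.
      apply Hlb; now exists U.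
    - unfold sum_Rbar.
      match goal with |- Rbar_le (Rbar_lub ?P) _ => destruct (Rbar_lub_correct P) as [_ Hl] end.
      apply Hl; intros v [n ->]; apply HM. }
  destruct (hausdorff_delta s d E) as [h| |] eqn:Eh; simpl in Hlt; [| |easy].
  + exists d, h; repeat split; try easy; intros U M H1 H2 H3; exact (Hle U M H1 H2 H3).
  (* An infinite content excludes every finite [M], so any [eta] serves. *)
  + exists d, 1; repeat split; try lra; intros U M H1 H2 H3; destruct (Hle U M H1 H2 H3).
- exfalso; apply Hm; unfold hausdorff_measure.
  assert (Hz : forall d, 0 < d -> hausdorff_delta s d E = Finite 0).
  { intros d Hd; apply Rbar_le_antisym; [|apply Hpos].
    apply Rbar_not_lt_le; intros Hl; apply Hno; now exists d. }
  match goal with |- Rbar_lub ?P = _ => destruct (Rbar_lub_correct P) as [Hu Hl] end.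
  apply Rbar_le_antisym.
  + apply Hl; intros v [d [Hd ->]]; rewrite Hz by exact Hd; apply Rbar_le_refl.
  + apply Hu; exists 1; split; [lra|]; now rewrite Hz by lra.
Qed.

Lemma diam_le (U : R -> Prop) d :
  (forall x y, U x -> U y -> Rabs (x - y) <= d) -> Rbar_le (diam U) (Finite d).
Proof.
intros H; unfold diam.
match goal with |- Rbar_le (Lub_Rbar ?P) _ => destruct (Lub_Rbar_correct P) as [_ Hl] end.
apply Hl; intros v [x [y [Hx [Hy ->]]]]; now apply H.
Qed.

Lemma diam_pow_le s U d : 0 < s -> 0 < d -> Rbar_le (diam U) (Finite d) ->
  diam_pow s U <= Rpower d s.
Proof.
intros Hs Hd H; assert (0 < Rpower d s) by apply exp_pos.
unfold diam_pow; destruct (diam U) as [r| |]; try lra.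
destruct (Rle_dec r 0); [destruct (Req_EM_T s 0); lra|].
simpl in H; apply Rle_Rpower_l; lra.
Qed.

Lemma diam_pow_empty s U : 0 < s -> (forall x, ~ U x) -> diam_pow s U = 0.
Proof.
intros Hs H; assert (Hd : Rbar_le (diam U) (Finite 0)).
{ apply diam_le; intros x y Hx; now destruct (H x). }
unfold diam_pow; destruct (diam U) as [r| |]; try lra.
simpl in Hd; destruct (Rle_dec r 0); [|lra]; destruct (Req_EM_T s 0); lra.
Qed.

Lemma sum_n_finite_support (f : nat -> R) N c : 0 <= c ->
  (forall i, (i < N)%nat -> f i <= c) -> (forall i, (N <= i)%nat -> f i = 0) ->
  forall n, sum_n f n <= INR N * c.
Proof.
intros Hc Hf H0 n.
(* [sum_n f n] has [n + 1] terms, and only those of index below [N] can be nonzero. *)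
assert (H : sum_n f n <= INR (min (S n) N) * c).
{ induction n as [|n IH].
  - rewrite sum_O; destruct N as [|N]; [rewrite H0 by lia; simpl; lra|].
    replace (min 1 (S N)) with 1%nat by lia; change (INR 1) with 1; rewrite Rmult_1_l;
      apply Hf; lia.
  - rewrite sum_Sn; change (plus (sum_n f n) (f (S n))) with (sum_n f n + f (S n)).
    destruct (le_lt_dec N (S n)) as [Hn|Hn].
    + rewrite H0 by exact Hn.
      replace (min (S (S n)) N) with (min (S n) N) by lia; lra.
    + replace (min (S (S n)) N) with (S (min (S n) N)) by lia.
      rewrite S_INR; specialize (Hf (S n) Hn); lra. }
apply Rle_trans with (1 := H); apply Rmult_le_compat_r; [exact Hc | apply le_INR; lia].
Qed.

(** The list becomes a sequence of sets when continued by empty ones, which cost nothing as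
    [s > 0]. *)
Lemma finite_cover_bound s E : 0 < s -> Rbar_lt (Finite s) (hausdorff_dim E) ->
  exists rho eta, 0 < rho /\ 0 < eta /\
  forall (I : Type) (l : list I) (V : I -> R -> Prop) (d : R), 0 < d <= rho ->
    (forall x, E x -> exists i, In i l /\ V i x) ->
    (forall i x y, In i l -> V i x -> V i y -> Rabs (x - y) <= d) ->
    eta <= INR (length l) * Rpower d s.
Proof.
intros Hs Hdim; destruct (hausdorff_lower s E) as [rho [eta [Hr [He H]]]]; [lra | exact Hdim|].
exists rho, eta; repeat split; try easy; intros I l V d Hd Hcov Hdi.
set (U := fun (n : nat) x => exists i, nth_error l n = Some i /\ V i x).
assert (Hdiam : forall n, Rbar_le (diam (U n)) (Finite d)).
{ intros n; apply diam_le; intros x y [i [Hi Hx]] [j [Hj Hy]].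
  rewrite Hi in Hj; injection Hj as <-; apply (Hdi i); try easy; now apply nth_error_In in Hi. }
apply (H U).
- intros x Hx; destruct (Hcov x Hx) as [i [Hi Hv]].
  destruct (In_nth_error _ _ Hi) as [n Hn]; now exists n, i.
- intros n; apply Rbar_le_trans with (1 := Hdiam n); simpl; lra.
- apply sum_n_finite_support.
  + left; apply exp_pos.
  + intros n _; apply diam_pow_le; try easy.
  + intros n Hn; apply diam_pow_empty; [easy|]; intros x [i [Hi _]].
    apply nth_error_None in Hn; congruence.
Qed.

(** * Counting words *)

Fixpoint words_upto (A : list nat) (n : nat) : list (list nat) :=
  match n with
  | O => nil :: nil
  | S n' => nil :: flat_map (fun w => map (fun b => b :: w) A) (words_upto A n')
  end.

Lemma in_words_upto A n w :
  In w (words_upto A n) <-> (length w <= n)%nat /\ (forall b, In b w -> In b A).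
Proof.
revert w; induction n as [|n IH]; intros w; simpl.
- split; [intros [<-|[]]; now split | intros [H _]; left; destruct w; [easy | simpl in H; lia]].
- rewrite in_flat_map; split.
  + intros [<-|[u [Hu Hw]]]; [simpl; split; [lia | easy]|].
    apply in_map_iff in Hw; destruct Hw as [b [<- Hb]]; apply IH in Hu; destruct Hu as [Hl HA].
    simpl; split; [lia|]; now intros k [<-|Hk]; [|apply HA].
  + intros [Hl HA]; destruct w as [|b w]; [now left|right]; exists w; split.
    * apply IH; simpl in Hl; split; [lia|]; intros k Hk; apply HA; now right.
    * apply in_map_iff; exists b; split; [easy | apply HA; now left].
Qed.

(** The Euclidean algorithm returns the letters as long as each remainder is smaller than its
    divisor; [2 <= c] secures this at the last letter, from where it propagates. *)
Lemma cf_pair_quotients w c : pos_word w -> (2 <= c)%nat ->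
  (fst (cf_pair (w ++ c :: nil)) < denom (w ++ c :: nil))%nat /\
  forall f, (length (w ++ c :: nil) <= f)%nat ->
    cf_aux f (fst (cf_pair (w ++ c :: nil))) (denom (w ++ c :: nil)) = w ++ c :: nil.
Proof.
intros Hw Hc; induction w as [|b w IH].
- simpl; split; [lia|]; intros [|f] Hf; [lia|]; cbn [cf_aux Nat.eqb].
  replace (c * 1 + 0)%nat with c by lia; rewrite Nat.div_1_r, Nat.mod_1_r.
  now destruct f.
- destruct (pos_word_cons _ _ Hw) as [Hb Hw']; destruct (IH Hw') as [Hlt Haux].
  simpl app; cbn [cf_pair fst snd length].
  set (a := fst (cf_pair (w ++ c :: nil))) in *; set (q := denom (w ++ c :: nil)) in *.
  assert (Ha : (1 <= a)%nat \/ w = nil).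
  { destruct w as [|b' w]; [now right|left].
    unfold a; simpl; apply (length_le_denom (w ++ c :: nil)).
    intros k Hk; apply in_app_or in Hk; destruct Hk as [Hk|[<-|[]]]; [|lia].
    apply Hw'; now right. }
  assert (q < b * q + a)%nat.
  { destruct Ha as [Ha| ->]; [nia|]; unfold q, a; simpl; nia. }
  split; [easy|]; intros [|f] Hf; [lia|]; cbn [cf_aux].
  destruct (Nat.eqb_spec q 0) as [Hq|Hq]; [lia|].
  rewrite <- (Nat.div_unique (b * q + a) q b a) by (easy || lia).
  rewrite <- (Nat.mod_unique (b * q + a) q b a) by (easy || lia).
  f_equal; apply Haux; lia.
Qed.

Lemma cf_pair_gcd w : Nat.gcd (fst (cf_pair w)) (denom w) = 1%nat.
Proof.
induction w as [|b w IH]; [reflexivity|]; cbn [cf_pair fst snd].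
now rewrite Nat.add_comm, Nat.gcd_add_mult_diag_r, Nat.gcd_comm.
Qed.

Lemma partial_quotients_cf_pair w c : pos_word w -> (2 <= c)%nat ->
  partial_quotients (fst (cf_pair (w ++ c :: nil))) (denom (w ++ c :: nil)) = w ++ c :: nil.
Proof.
intros Hw Hc; apply cf_pair_quotients; try easy; apply length_le_denom.
intros k Hk; apply in_app_or in Hk; destruct Hk as [Hk|[<-|[]]]; [now apply Hw | lia].
Qed.

Lemma list_bound (A : list nat) : exists B, (1 <= B)%nat /\ forall k, In k A -> (k <= B)%nat.
Proof.
induction A as [|a A [B [HB H]]]; [exists 1%nat; split; [lia | easy]|].
exists (Nat.max a B); split; [lia|]; intros k [<-|Hk]; [lia|]; specialize (H k Hk); lia.
Qed.

Section Count.
Variables (A : list nat) (c B : nat).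
Hypothesis A1 : forall k, In k A -> (1 <= k)%nat.
Hypothesis AB : forall k, In k A -> (k <= B)%nat.
Hypothesis c2 : (2 <= c)%nat.

(* Holds for the longest prefix of an expansion with [2 * c * denom w < p]. *)
Definition in_scale (p : nat) (w : list nat) : bool :=
  (Nat.ltb (2 * c * denom w) p && Nat.leb p (4 * c * B * denom w))%bool.

Definition scale_words (p : nat) : list (list nat) :=
  nodup (list_eq_dec Nat.eq_dec) (filter (in_scale p) (words_upto A p)).

Lemma in_scale_words p w : In w (scale_words p) <->
  (forall b, In b w -> In b A) /\ (2 * c * denom w < p)%nat /\ (p <= 4 * c * B * denom w)%nat.
Proof.
unfold scale_words; rewrite nodup_In, filter_In, in_words_upto; unfold in_scale.
rewrite Bool.andb_true_iff, Nat.ltb_lt, Nat.leb_le; split; [now intros [[_ H] H']|].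
intros [H H']; repeat split; try easy.
assert (pos_word w) by (intros k Hk; apply A1, H, Hk).
destruct (length_le_denom w) as [H1 _]; [easy|]; nia.
Qed.

(** Denominators of prefixes start at 1 and are at least the length, so [2 * c * denom] crosses [p];
    the crossing letter is at most [B] and multiplies the denominator by at most [2 * B]. *)
Lemma scale_cover p x : (2 * c < p)%nat -> F_set A x ->
  exists n, In (digits n x) (scale_words p).
Proof.
intros Hp Hx.
assert (Hpos : forall n, pos_word (digits n x)).
{ intros n k Hk; apply A1; eapply digits_in; eassumption. }
assert (Hn : exists n, (2 * c * denom (digits n x) < p)%nat /\
  (p <= 2 * c * denom (digits (S n) x))%nat).
{ assert (Hlarge : (p <= 2 * c * denom (digits p x))%nat).
  { destruct (length_le_denom _ (Hpos p)) as [H _].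
    unfold digits at 1 in H; rewrite length_map, length_seq in H; nia. }
  assert (H0 : (2 * c * denom (digits 0 x) < p)%nat) by (simpl; lia).
  revert Hlarge; generalize p at 2 as N; intros N; induction N as [|N IH]; [lia|intros HN].
  destruct (le_lt_dec p (2 * c * denom (digits N x))) as [H|H]; [now apply IH | now exists N]. }
destruct Hn as [n [H1 H2]]; exists n; apply in_scale_words.
split; [intros b; now apply digits_in with (1 := Hx)|]; split; [exact H1|].
rewrite digits_succ in H2; set (k := Z.to_nat (cf_digit n x)) in *.
assert (Hk : In k A).
{ apply (digits_in A x Hx (S n)); rewrite digits_succ; apply in_or_app; right; now left. }
assert (Hk1 : pos_word (k :: nil)) by (intros j [<-|[]]; now apply A1).
assert (H := ModularHit.denom_app (Hpos n) Hk1); simpl in H |- *; specialize (AB k Hk).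
set (q := denom (digits n x)) in *.
assert (2 * c * denom (digits n x ++ k :: nil) <= 2 * c * (2 * q * k))%nat by (apply Nat.mul_le_mono_l; simpl; lia).
assert (2 * c * (2 * q * k) <= 4 * c * B * q)%nat by nia.
simpl in *; lia.
Qed.
End Count.

(** The cylinders of these words cover and have diameter at most [(D / p)^2] with [D = 4 * c * B].
    The cover bound reads [eta <= N (D / p)^(2 s)], where [2 s = 1 + 2 delta]. *)
Lemma scale_words_count (A : list nat) (c B : nat) (delta : R) :
  (forall k, In k A -> (1 <= k)%nat) -> (forall k, In k A -> (k <= B)%nat) ->
  (2 <= c)%nat -> (1 <= B)%nat -> 0 < delta ->
  Rbar_lt (Finite (1 / 2 + delta)) (hausdorff_dim (F_set A)) ->
  exists kappa p0, 0 < kappa /\ forall p : nat, (p0 <= p)%nat ->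
    kappa * Rpower (INR p) (1 + 2 * delta) <= INR (length (scale_words A c B p)).
Proof.
intros A1 AB c2 B1 Hdel Hdim.
set (s := 1 / 2 + delta) in *; assert (Hs : 0 < s) by (unfold s; lra).
destruct (finite_cover_bound s (F_set A) Hs Hdim) as [rho [eta [Hr [He H]]]].
set (D := INR (4 * c * B)).
assert (HD : 1 <= D) by (apply (le_INR 1); nia).
(* Above this threshold both [(D / p)^2 <= rho] and [2 * c < p] hold. *)
destruct (nfloor_ex (Rmax 0 (D * D / rho + INR (2 * c)))) as [P [_ HP]]; [apply Rmax_l|].
assert (HP1 := Rmax_r 0 (D * D / rho + INR (2 * c))).
exists (eta / Rpower D (1 + 2 * delta)), (S P); split.
{ apply Rdiv_lt_0_compat; [easy | apply exp_pos]. }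
intros p Hp; apply le_INR in Hp; rewrite S_INR in Hp.
assert (Hdr : 0 <= D * D / rho) by (apply Rdiv_le_0_compat; nra).
assert (Hpc : (2 * c < p)%nat) by (apply INR_lt; lra).
assert (Hp1 : 1 <= INR p) by (apply (le_INR 1); lia).
assert (Hx : 0 < D / INR p) by (apply Rdiv_lt_0_compat; lra).
set (d := (D / INR p) * (D / INR p)).
assert (Hd0 : 0 < d) by (unfold d; nra).
assert (Hd : d <= rho).
{ unfold d; replace (D / INR p * (D / INR p)) with (D * D / (INR p * INR p)) by (field; lra).
  assert (D * D <= rho * INR p).
  { replace (D * D) with (rho * (D * D / rho)) by (field; lra).
    apply Rmult_le_compat_l; [lra|]; assert (0 <= INR (2 * c)) by apply pos_INR; lra. }
  apply Rmult_le_reg_r with (INR p * INR p); [nra|].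
  unfold Rdiv; rewrite Rmult_assoc, Rinv_l, Rmult_1_r by nra; nra. }
set (V := fun w x => exists y, 0 <= y <= 1 /\ x = mob w y).
assert (Hcount : eta <= INR (length (scale_words A c B p)) * Rpower d s).
{ apply (H (list nat) _ V); [easy| |].
  - intros x HxA; destruct (scale_cover A c B A1 AB c2 p x Hpc HxA) as [n Hn].
    exists (digits n x); split; [easy|]; exists (Nat.iter n gauss_map x); split.
    + now apply (gauss_step A).
    + now apply (expansion A).
  - intros w x y Hw [x' [Hx' ->]] [y' [Hy' ->]].
    apply in_scale_words in Hw; try easy; destruct Hw as [HwA [_ Hw]].
    assert (Hpw : pos_word w) by (intros k Hk; apply A1, HwA, Hk).
    apply Rle_trans with (1 := mob_diam w x' y' Hpw Hx' Hy').
    apply le_INR in Hw; rewrite mult_INR in Hw; fold D in Hw.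
    assert (Hq : 0 < INR (denom w)).
    { apply (lt_INR 0); destruct (length_le_denom w Hpw); lia. }
    assert (Hi : / INR (denom w) <= D / INR p).
    { apply Rmult_le_reg_r with (INR (denom w) * INR p); [nra|].
      replace (/ INR (denom w) * (INR (denom w) * INR p)) with (INR p) by (field; lra).
      replace (D / INR p * (INR (denom w) * INR p)) with (D * INR (denom w)) by (field; lra);
        exact Hw. }
    rewrite Rinv_mult; assert (0 < / INR (denom w)) by now apply Rinv_0_lt_compat.
    unfold d; apply Rmult_le_compat; lra. }
assert (Hpow : Rpower d s * Rpower (INR p) (1 + 2 * delta) = Rpower D (1 + 2 * delta)).
{ unfold d; rewrite <- Rpower_mult_distr, <- Rpower_plus by easy.
  replace (s + s) with (1 + 2 * delta) by (unfold s; lra).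
  rewrite Rpower_mult_distr by (easy || lra); f_equal; field; lra. }
assert (HD0 : 0 < Rpower D (1 + 2 * delta)) by apply exp_pos.
assert (Hp0 : 0 < Rpower (INR p) (1 + 2 * delta)) by apply exp_pos.
apply Rmult_le_reg_r with (Rpower D (1 + 2 * delta)); [easy|].
replace (eta / Rpower D (1 + 2 * delta) * Rpower (INR p) (1 + 2 * delta) * Rpower D (1 + 2 * delta))
  with (eta * Rpower (INR p) (1 + 2 * delta)) by (field; lra).
rewrite <- Hpow, <- Rmult_assoc; apply Rmult_le_compat_r; [lra | exact Hcount].
Qed.

(** The exponent condition gives [N^m >= kappa^m p^(m + 2)]; one factor [p] absorbs [4^m / kappa^m],
    leaving the form that [modular_hit] asks for. *)
Lemma power_count (N p m : nat) (kappa e : R) : (1 <= p)%nat -> 0 < kappa ->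
  kappa * Rpower (INR p) e <= INR N -> INR (m + 2) <= e * INR m ->
  4 ^ m <= kappa ^ m * INR p ->
  (Nat.mul (Nat.pow (Nat.mul 4 p) m) p <= Nat.pow N m)%nat.
Proof.
intros Hp Hk HN He H4; apply INR_le.
assert (Hp1 : 1 <= INR p) by (apply (le_INR 1); easy).
rewrite mult_INR, !pow_INR, mult_INR.
assert (HR : 0 < Rpower (INR p) e) by apply exp_pos.
apply Rle_trans with ((kappa * Rpower (INR p) e) ^ m); [|apply pow_incr; nra].
rewrite !Rpow_mult_distr.
assert (Hpe : INR p ^ (m + 2) <= Rpower (INR p) e ^ m).
{ rewrite <- (Rpower_pow (m + 2)), <- (Rpower_pow m (Rpower _ _)), Rpower_mult by (easy || lra).
  destruct (Req_dec (INR p) 1) as [->|Hne].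
  - unfold Rpower; rewrite ln_1, !Rmult_0_r; lra.
  - apply Rle_Rpower; lra. }
assert (Hpm : 0 < INR p ^ m) by (apply pow_lt; lra).
assert (Hkm : 0 < kappa ^ m) by (apply pow_lt; lra).
apply Rle_trans with (kappa ^ m * INR p ^ (m + 2)); [|apply Rmult_le_compat_l; lra].
rewrite pow_add; replace (INR 4) with 4 by (simpl; lra); simpl (INR p ^ 2).
replace (4 ^ m * INR p ^ m * INR p) with (4 ^ m * (INR p ^ m * INR p)) by ring.
replace (kappa ^ m * (INR p ^ m * (INR p * (INR p * 1))))
  with (kappa ^ m * INR p * (INR p ^ m * INR p)) by ring.
apply Rmult_le_compat_r; nra.
Qed.

(** * Passage to fractions and to all primes *)

Lemma nat_above (x : R) : exists n : nat, x <= INR n.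
Proof.
destruct (Rle_lt_dec x 0) as [H|H]; [exists 0%nat; exact H|].
destruct (nfloor_ex x) as [n [_ Hn]]; [lra|]; exists (S n); rewrite S_INR; lra.
Qed.

Lemma two_members (A : list nat) : NoDup A -> (2 <= length A)%nat ->
  exists b1 b2, In b1 A /\ In b2 A /\ (b2 < b1)%nat.
Proof.
destruct A as [|a [|b A]]; simpl; intros HA Hl; [lia | lia|].
inversion_clear HA as [|? ? Hab _]; destruct (lt_eq_lt_dec a b) as [[H|H]|H].
- exists b, a; intuition.
- destruct Hab; left; now symmetry.
- exists a, b; intuition.
Qed.

Lemma fraction_of_word (A : list nat) (w : list nat) (c p : nat) :
  (forall k, In k A -> (1 <= k)%nat) -> (forall b, In b w -> In b A) -> In c A -> (2 <= c)%nat ->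
  (p <> 0)%nat -> Nat.divide p (denom (w ++ c :: nil)) ->
  (0 < fst (cf_pair (w ++ c :: nil)))%nat /\
  (fst (cf_pair (w ++ c :: nil)) < denom (w ++ c :: nil))%nat /\
  Nat.gcd (fst (cf_pair (w ++ c :: nil))) (denom (w ++ c :: nil)) = 1%nat /\
  (denom (w ++ c :: nil) mod p = 0)%nat /\
  (forall b, In b (partial_quotients (fst (cf_pair (w ++ c :: nil))) (denom (w ++ c :: nil))) -> In b A).
Proof.
intros A1 Hw Hc c2 Hp0 Hp; assert (Hpw : pos_word w) by (intros k Hk; apply A1, Hw, Hk).
assert (HwA : forall b, In b (w ++ c :: nil) -> In b A).
{ intros b Hb; apply in_app_or in Hb; destruct Hb as [Hb|[<-|[]]]; [now apply Hw | easy]. }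
repeat split.
- apply length_le_denom; [intros k Hk; apply A1, HwA, Hk | now destruct w].
- now apply cf_pair_quotients.
- apply cf_pair_gcd.
- now apply Nat.Lcm0.mod_divide.
- now rewrite partial_quotients_cf_pair.
Qed.

Lemma bounded_choice (P : nat -> nat -> Prop) : (forall p, exists q, P p q) ->
  forall N, exists M, forall p, (p < N)%nat -> exists q, P p q /\ (q <= M)%nat.
Proof.
intros H; induction N as [|N [M HM]]; [exists 0%nat; lia|].
destruct (H N) as [q Hq]; exists (Nat.max M q); intros p Hp.
destruct (Nat.eq_dec p N) as [->|Hne]; [exists q; split; [easy | lia]|].
destruct (HM p) as [q' [Hq' Hl]]; [lia|]; exists q'; split; [easy | lia].
Qed.

Theorem theorem19 :
  forall (A : list nat) (delta : R),
    NoDup A -> (2 <= length A)%nat -> (forall k, In k A -> (1 <= k)%nat) ->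
    0 < delta ->
    Rbar_lt (Finite (1 / 2 + delta)) (hausdorff_dim (F_set A)) ->
    exists (C : nat) (K : R),
      forall p : nat, prime (Z.of_nat p) ->
        exists q a : nat,
          (0 < a)%nat /\ (a < q)%nat /\ Nat.gcd a q = 1%nat /\
          INR q <= K * INR p ^ C /\ (q mod p = 0)%nat /\
  (forall b, In b (partial_quotients a q) -> In b A).
Proof.
intros A delta HA HA2 A1 Hdel Hdim.
(* The larger of two letters serves both as [b1] and as the outer letter [c]; lying above a positive
   letter, it is at least 2. *)
destruct (two_members A HA HA2) as [c [b2 [cA [b2A Hb]]]].
assert (c2 : (2 <= c)%nat) by (specialize (A1 b2 b2A); lia).
destruct (list_bound A) as [B [B1 AB]].
destruct (scale_words_count A c B delta A1 AB c2 B1 Hdel Hdim) as [kappa [p1 [Hk Hcount]]].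
(* The growth estimate needs 28, and [m + 2 <= (1 + 2 delta) m] needs [delta * m >= 1]. *)
destruct (nat_above (/ delta)) as [m0 Hm0]; set (m := Nat.max 28 m0).
assert (Hm : / delta <= INR m) by (apply Rle_trans with (1 := Hm0), le_INR; lia).
destruct (@ModularHit.modular_hit_list A c b2 c m A1 cA b2A Hb cA) as [p2 [C Hhit]]; [lia|].
destruct (nat_above (4 ^ m / kappa ^ m)) as [p3 Hp3].
destruct (bounded_choice (fun p q => prime (Z.of_nat p) -> exists w,
  (forall b, In b w -> In b A) /\ Nat.divide p (denom (w ++ c :: nil)) /\ q =
    denom (w ++ c :: nil)))
  with (N := (p1 + p2 + p3)%nat) as [M HM].
{ intros p; destruct (classic (prime (Z.of_nat p))) as [Hp|Hp]; [|now exists 0%nat].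
  destruct (@ModularHit.denom_divide_repeat p c Hp) as [[|n] Hn].
  (* The empty word has denominator 1, which no prime divides, so a last letter [c] can be split
     off. *)
  { apply Nat.divide_1_r in Hn; subst p; now apply not_prime_1 in Hp. }
  cbn [repeat] in Hn; rewrite repeat_cons in Hn.
  eexists; intros _; exists (repeat c n); repeat split; [|exact Hn].
  intros b Hbn; now rewrite (repeat_spec _ _ _ Hbn). }
(* [INR M] covers the finitely many small primes, and [2 ^ C] comes from the bound [(2 p)^C] for the
   others. *)
exists C, (INR M + 2 ^ C); intros p Hp.
assert (Hp1 : (1 < p)%nat) by (apply prime_ge_2 in Hp; lia).
assert (HpC : 1 <= INR p ^ C) by (apply pow_R1_Rle, (le_INR 1); lia).
assert (H2C : 0 < 2 ^ C) by (apply pow_lt; lra).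
assert (HM0 : 0 <= INR M) by apply pos_INR.
assert (Hw : exists w, (forall b, In b w -> In b A) /\ Nat.divide p (denom (w ++ c :: nil)) /\
  INR (denom (w ++ c :: nil)) <= (INR M + 2 ^ C) * INR p ^ C).
{ destruct (le_lt_dec (p1 + p2 + p3) p) as [Hlarge|Hsmall].
  - destruct (Hhit p Hp) with (ws := map (fun w => w ++ c :: nil) (scale_words A c B p))
      as [w [HwA Hdiv Hle]].
    + lia.
    (* The final letter [c >= 2] excludes the ambiguity [..., b, 1] = [..., b + 1]
       and makes words recoverable from their fractions. *)
    + apply Injective_map_NoDup; [|apply NoDup_nodup].
      intros u v; apply app_inv_tail.
    + intros w Hw b Hbw; apply in_map_iff in Hw; destruct Hw as [u [<- Hu]].
      apply in_scale_words in Hu; try easy.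
      apply in_app_or in Hbw; destruct Hbw as [Hbw|[<-|[]]]; [now apply Hu | easy].
    + intros w Hw; apply in_map_iff in Hw; destruct Hw as [u [<- Hu]].
      apply in_scale_words in Hu; try easy; destruct Hu as [HuA [Hu _]].
      assert (Hcc : forall k, In k (c :: nil) -> (1 <= k)%nat) by (intros k [<-|[]]; lia).
      (* The factor [2 * c] in [in_scale] pays for the appended letter. *)
      assert (H := ModularHit.denom_app (fun k Hk => A1 k (HuA k Hk)) Hcc).
      replace (denom (c :: nil)) with c in H by (simpl; lia); nia.
    + intros u v Hu Hv E; apply in_map_iff in Hu, Hv.
      destruct Hu as [u' [<- Hu]], Hv as [v' [<- Hv]].
      apply in_scale_words in Hu, Hv; try easy.
      rewrite <- (partial_quotients_cf_pair u' c), <- (partial_quotients_cf_pair v' c), E; try easy.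
      * intros k Hk'; now apply A1, Hv.
      * intros k Hk'; now apply A1, Hu.
    + rewrite length_map.
      apply power_count with (kappa := kappa) (e := 1 + 2 * delta); [lia | easy | apply Hcount;
        lia | |].
      * rewrite plus_INR; simpl (INR 2).
        assert (1 <= delta * INR m); [|lra].
        apply Rmult_le_reg_l with (/ delta); [now apply Rinv_0_lt_compat|].
        rewrite <- Rmult_assoc, Rinv_l by lra; lra.
      * assert (Hkm : 0 < kappa ^ m) by now apply pow_lt.
        replace (4 ^ m) with (kappa ^ m * (4 ^ m / kappa ^ m)) by (field; lra).
        apply Rmult_le_compat_l; [lra|]; apply Rle_trans with (1 := Hp3), le_INR; lia.
    + exists (c :: w); split; [|split; [exact Hdiv|]].
      * now intros b [<-|Hbw]; [|apply HwA].
      * apply le_INR in Hle; rewrite pow_INR, mult_INR, Rpow_mult_distr in Hle.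
        simpl (INR 2) in Hle; simpl app; replace (1 + 1) with 2 in Hle by ring; nra.
  - destruct (HM p Hsmall) as [q [Hq HqM]]; destruct (Hq Hp) as [w [HwA [Hdiv ->]]].
    exists w; repeat split; [easy | easy|]; apply le_INR in HqM; nra. }
destruct Hw as [w [HwA [Hdiv Hle]]].
destruct (fraction_of_word A w c p A1 HwA cA c2) as [H1 [H2 [H3 [H4 H5]]]]; [lia | easy|].
now exists (denom (w ++ c :: nil)), (fst (cf_pair (w ++ c :: nil))).
Qed.
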